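(* Let $t_1<t_2$ and let $(\rho,\boldsymbol m,E,\boldsymbol H)$ be a (sufficiently smooth) solution on $\Omega\times[t_1,t_2]$ of the system $$\begin{aligned} \partial_t\rho&=0,\\ \partial_t\boldsymbol m-\mu\,\mathrm{curl}\boldsymbol H\times\boldsymbol H&=\boldsymbol 0,\\ \partial_tE-\mu(\mathrm{curl}\boldsymbol H\times\boldsymbol H)\cdot\tfrac{\boldsymbol m}{\rho}-r|\mathrm{curl}\boldsymbol H|^2&=0,\\ \partial_t\boldsymbol H-\mathrm{curl}\big(\tfrac{\boldsymbol m}{\rho}\times\boldsymbol H\big)+\mathrm{curl}\big(\tfrac{r}{\mu}\mathrm{curl}\boldsymbol H+\tfrac{d_i}{\rho}\mathrm{curl}\boldsymbol H\times\boldsymbol H\big)&=\boldsymbol 0 . \end{aligned}$$ Write $\boldsymbol v=\boldsymbol m/\rho$ and $e=\tfrac{E}{\rho}-\tfrac12|\boldsymbol v|^2$. Assume that at time $t_1$, for all $\boldsymbol x\in\Omega$, $$\rho(\boldsymbol x,t_1)>0,\qquad e(\boldsymbol x,t_1)>0,\qquad \theta(\rho(\boldsymbol x,t_1),e(\boldsymbol x,t_1))>0 .$$ Then the following properties hold. (1) Global energy balance: $$\begin{aligned} &\int_\Omega\big(\tfrac12\rho|\boldsymbol v|^2+\tfrac{\mu}{2}|\boldsymbol H|^2\big)(\boldsymbol x,t_2)\,d\boldsymbol x\\ &\quad+\int_{t_1}^{t_2}\!\int_{\partial\Omega}\Big(r\,\mathrm{curl}\boldsymbol H-\mu(\boldsymbol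 v\times\boldsymbol H)+\tfrac{\mu d_i}{\rho}\mathrm{curl}\boldsymbol H\times\boldsymbol H\Big)\cdot(\boldsymbol H\times\boldsymbol n)\,ds\,dt\\ &=\int_\Omega\big(\tfrac12\rho|\boldsymbol v|^2+\tfrac{\mu}{2}|\boldsymbol H|^2\big)(\boldsymbol x,t_1)\,d\boldsymbol x-\int_{t_1}^{t_2}\!\int_\Omega r|\mathrm{curl}\boldsymbol H|^2\,d\boldsymbol x\,dt . \end{aligned}$$ (2) Pointwise, for every $\boldsymbol x\in\Omega$: $$\begin{aligned} (E-\tfrac12\rho|\boldsymbol v|^2)(\boldsymbol x,t_2)&=(E-\tfrac12\rho|\boldsymbol v|^2)(\boldsymbol x,t_1)+\int_{t_1}^{t_2}r|\mathrm{curl}\boldsymbol H|^2(\boldsymbol x,t)\,dt,\\ \theta(\rho(\boldsymbol x,t_2),e(\boldsymbol x,t_2))&\ge\theta(\rho(\boldsymbol x,t_1),e(\boldsymbol x,t_1)),\\ s(\rho(\boldsymbol x,t_2),e(\boldsymbol x,t_2))&\ge s(\rho(\boldsymbol x,t_1),e(\boldsymbol x,t_1)),\\ \eta(\rho(\boldsymbol x,t_2),e(\boldsymbol x,t_2))&\le\eta(\rho(\boldsymbol x,t_1),e(\boldsymbol x,t_1)). \end{aligned}$$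
   Context: $\Omega\subset\mathbb R^3$ is a bounded domain with sufficiently regular boundary and outward unit normal $\boldsymbol n$. The unknowns are the density $\rho\in\mathbb R$, momentum $\boldsymbol m\in\mathbb R^3$, total mechanical energy $E\in\mathbb R$ and magnetic field $\boldsymbol H\in\mathbb R^3$, functions of $(\boldsymbol x,t)$. The constants $\mu>0$, $r\ge 0$ (resistivity) and $d_i>0$ are given. Equation of state. The specific entropy is a given twice continuously differentiable function $s=s(\mathsf v,e)$ of the specific volume $\mathsf v=1/\rho>0$ and the specific internal energy $e>0$, on a domain contained in $\mathbb R^+\times\mathbb R^+$; all thermodynamic states occurring are in this domain. Abusing notation, $s(\rho,e)$ means $s(1/\rho,e)$. The temperature is $\theta(\rho,e):=\big[\tfrac{\partial s}{\partial e}(1/\rho,e)\big]^{-1}$ and the mathematical entropy is $\eta(\rho,e):=-\rho\,s(\rho,e)$. Standing assumptions on the equation of state: (i) $\partial s/\partial e=1/\theta>0$ on the domain of $s$; (ii) $s$ is concave: $\frac{\partial^2s}{\partial \mathsf v^2}\le0$, $\frac{\partial^2s}{\partial e^2}\le0$ and $\frac{\partial^2s}{\partial \mathsf v^2}\frac{\partial^2s}{\partial e^2}-\big(\frac{\partial^2s}{\partial \mathsf v\partial e}\big)^2\ge0$. *)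

(* Defs.v *)
From HB Require Import structures.
From mathcomp Require Export all_boot all_order all_algebra.
From mathcomp Require Export all_classical all_reals all_analysis.
From mathcomp Require Export measurable_realfun.
Export Order.TTheory GRing.Theory Num.Theory.
Export numFieldNormedType.Exports.

Set Implicit Arguments.
Unset Strict Implicit.
Unset Printing Implicit Defensive.

Local Open Scope classical_set_scope.
Local Open Scope ring_scope.

(* f is of class C^k on the open set U; the directions v range over the whole
   (finite-dimensional) space, so that this amounts to continuity of all the
   partial derivatives of order at most k. *)
Fixpoint Ck {R : realType} {V W : normedModType R} (k : nat) (U : set V)
    (f : V -> W) : Prop :=
  match k with
  | 0%N => forall x, U x -> {for x, continuous f}
  | k'.+1 => (forall x, U x -> differentiable f x) /\
             (forall v : V, Ck k' U ('D_v f))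
  end.

(* Functions are total here: f of class C^k up to the boundary of the closed set A
   is identified with a C^k extension to an open neighbourhood of A. *)
Definition Ck_on_closed {R : realType} {V W : normedModType R} (k : nat)
    (A : set V) (f : V -> W) : Prop :=
  exists U : set V, [/\ open U, A `<=` U & Ck k U f].

Definition domain {T : topologicalType} (A : set T) : Prop :=
  [/\ open A, connected A & A !=set0].

Definition boundary {T : topologicalType} (A : set T) : set T :=
  closure A `\` interior A.

Definition dot {R : realType} (u v : 'rV[R]_3) : R := \sum_i u 0 i * v 0 i.

Definition normsq {R : realType} (u : 'rV[R]_3) : R := dot u u.

(* Indices are taken in Z/3Z. *)
Definition cross {R : realType} (u v : 'rV[R]_3) : 'rV[R]_3 :=
  \row_(i < 3) (u 0 (i + 1) * v 0 (i + 2) - u 0 (i + 2) * v 0 (i + 1)).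

Definition basis {R : realType} (i : 'I_3) : 'rV[R]_3 := delta_mx 0 i.

Definition partial {R : realType} (i : 'I_3) (f : 'rV[R]_3 -> R)
  : 'rV[R]_3 -> R := 'D_(basis i) f.

Definition curl {R : realType} (F : 'rV[R]_3 -> 'rV[R]_3) (x : 'rV[R]_3)
  : 'rV[R]_3 :=
  \row_(i < 3) (partial (i + 1) (fun y => F y 0 (i + 2)) x
              - partial (i + 2) (fun y => F y 0 (i + 1)) x).

(* Measures on R^3 live on R * R * R with the product of the Borel sigma-algebras
   (measurableTypeR R is R with the sigma-algebra on which lebesgue_measure is
   defined); [point3] transports them to row vectors. *)
Notation borel3 R :=
  (measurableTypeR R * measurableTypeR R * measurableTypeR R)%type.

Definition point3 {R : realType} (p : borel3 R) : 'rV[R]_3 :=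
  \row_(i < 3) [tuple p.1.1; p.1.2; p.2]`_i.

(* The library's sigma-finite instance of m1 \x m2 is shadowed by a later one for
   probabilities, hence the explicit proofs. *)
Lemma product_sigma_finite d1 d2 (T1 : measurableType d1)
    (T2 : measurableType d2) (R : realType)
    (m1 : {sigma_finite_measure set T1 -> \bar R})
    (m2 : {sigma_finite_measure set T2 -> \bar R}) :
  sigma_finite setT (m1 \x m2)%E.
Proof.
have /sigma_finiteP[F [TF ndF Foo]] := sigma_finiteT m1.
have /sigma_finiteP[G [TG ndG Goo]] := sigma_finiteT m2.
exists (fun n => F n `*` G n).
  rewrite -setXTT TF TG predeqE => -[x y]; split.
    move=> [/= [n _ Fnx] [k _ Gky]]; exists (maxn n k) => //; split.
    - by move: x Fnx; exact/subsetPset/ndF/leq_maxl.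
    - by move: y Gky; exact/subsetPset/ndG/leq_maxr.
  by move=> [n _ []/= ? ?]; split; exists n.
move=> k; have [? ?] := Foo k; have [? ?] := Goo k.
split; first exact: measurableX.
by rewrite product_measure1E// lte_mul_pinfty// ge0_fin_numE.
Qed.

Definition lebesgue2 {R : realType} :=
  ((@lebesgue_measure R) \x (@lebesgue_measure R))%E.
HB.instance Definition _ (R : realType) := Measure.on (@lebesgue2 R).
HB.instance Definition _ (R : realType) :=
  Measure_isSigmaFinite.Build _ _ _ (@lebesgue2 R)
    (product_sigma_finite (@lebesgue_measure R) (@lebesgue_measure R)).

Definition lebesgue3 {R : realType} :=
  ((@lebesgue2 R) \x (@lebesgue_measure R))%E.
HB.instance Definition _ (R : realType) := Measure.on (@lebesgue3 R).
HB.instance Definition _ (R : realType) :=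
  Measure_isSigmaFinite.Build _ _ _ (@lebesgue3 R)
    (product_sigma_finite (@lebesgue2 R) (@lebesgue_measure R)).

Definition volume_integral {R : realType} (A : set 'rV[R]_3)
    (f : 'rV[R]_3 -> R) : R :=
  \int[@lebesgue3 R]_(p in point3 @^-1` A) f (point3 p).

Definition time_integral {R : realType} (a b : R) (f : R -> R) : R :=
  \int[@lebesgue_measure R]_(t in `[a, b]) f t.

(* The point over y in the graph of x_k = g (x_{k+1}, x_{k+2}). *)
Definition graph_point {R : realType} (k : 'I_3) (g : R * R -> R) (y : R * R)
  : 'rV[R]_3 :=
  \row_(i < 3) (if i == k then g y else if i == k + 1 then y.1 else y.2).

(* In the open set U, Om is, after relabelling and reorienting the coordinate
   axes, the region on one side of the graph of a C^1 function: below the graph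
   of x_k = g (x_{k+1}, x_{k+2}) if b = false, above it if b = true. *)
Definition graph_chart {R : realType} (Om U : set 'rV[R]_3) (k : 'I_3)
    (b : bool) (g : R * R -> R) : Prop :=
  [/\ open U, Ck 1 setT g &
      forall x, U x ->
        (Om x <-> 0 < (-1) ^+ b * (g (x 0 (k + 1), x 0 (k + 2)) - x 0 k))].

Definition C1_boundary {R : realType} (Om : set 'rV[R]_3) : Prop :=
  forall x, boundary Om x -> exists U k b g, U x /\ graph_chart Om U k b g.

Definition area_density {R : realType} (g : R * R -> R) (y : R * R) : R :=
  Num.sqrt (1 + ('D_(1, 0) g y) ^+ 2 + ('D_(0, 1) g y) ^+ 2).

Definition outward_unit_normal {R : realType} (Om : set 'rV[R]_3)
    (n : 'rV[R]_3 -> 'rV[R]_3) : Prop :=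
  forall U k b g, graph_chart Om U k b g ->
  forall x, U x -> boundary Om x ->
    let y := (x 0 (k + 1), x 0 (k + 2)) in
    n x = ((-1) ^+ b / area_density g y) *:
          (basis k - 'D_(1, 0) g y *: basis (k + 1)
                   - 'D_(0, 1) g y *: basis (k + 2)).

(* sigma is the surface measure of the boundary of Om: it is carried by the
   boundary and in each chart it is sqrt (1 + |grad g|^2) dy.  These properties
   determine sigma, since the boundary of a bounded set is covered by finitely
   many charts. *)
Definition surface_measure {R : realType} (Om : set 'rV[R]_3)
    (sigma : {measure set (borel3 R) -> \bar R}) : Prop :=
  sigma (point3 @^-1` (~` boundary Om)) = 0%E /\
  forall U k b g, graph_chart Om U k b g ->
  forall f : 'rV[R]_3 -> \bar R,
    measurable_fun [set: borel3 R] (fun p => f (point3 p)) ->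
    (forall x, (0 <= f x)%E) -> (forall x, ~ U x -> f x = 0%E) ->
    (\int[sigma]_p f (point3 p) =
     \int[@lebesgue2 R]_y (f (graph_point k g y) * (area_density g y)%:E))%E.

Definition surface_integral {R : realType}
    (sigma : {measure set (borel3 R) -> \bar R})
    (S : set 'rV[R]_3) (f : 'rV[R]_3 -> R) : R :=
  \int[sigma]_(p in point3 @^-1` S) f (point3 p).

(* The specific entropy s is a function of the pair (specific volume, specific
   internal energy). *)
Definition ds_dv {R : realType} (s : R * R -> R) : R * R -> R := 'D_(1, 0) s.
Definition ds_de {R : realType} (s : R * R -> R) : R * R -> R := 'D_(0, 1) s.

Definition equation_of_state {R : realType} (D : set (R * R))
    (s : R * R -> R) : Prop :=
  [/\ domain D,
      (forall p, D p -> 0 < p.1 /\ 0 < p.2),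
      Ck 2 D s,
      (forall p, D p -> 0 < ds_de s p) &
      forall p, D p ->
        [/\ ds_dv (ds_dv s) p <= 0,
            ds_de (ds_de s) p <= 0 &
            0 <= ds_dv (ds_dv s) p * ds_de (ds_de s) p
                 - (ds_dv (ds_de s) p) ^+ 2]].

Definition entropy {R : realType} (s : R * R -> R) (rho e : R) : R :=
  s (rho^-1, e).

Definition temperature {R : realType} (s : R * R -> R) (rho e : R) : R :=
  (ds_de s (rho^-1, e))^-1.

Definition math_entropy {R : realType} (s : R * R -> R) (rho e : R) : R :=
  - rho * entropy s rho e.

Definition velocity {R : realType} (rho : 'rV[R]_3 -> R -> R)
    (m : 'rV[R]_3 -> R -> 'rV[R]_3) (x : 'rV[R]_3) (t : R) : 'rV[R]_3 :=
  (rho x t)^-1 *: m x t.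

Definition internal_energy {R : realType} (rho : 'rV[R]_3 -> R -> R)
    (m : 'rV[R]_3 -> R -> 'rV[R]_3) (E : 'rV[R]_3 -> R -> R)
    (x : 'rV[R]_3) (t : R) : R :=
  E x t / rho x t - 2^-1 * normsq (velocity rho m x t).

(* Main.v *)
Require Import Defs.
From mathcomp Require Import ring lra.

(** Two facts carry the theorem: the second law at each point, and Poynting's
    theorem integrated over the domain.

    At a fixed point the density is constant in time, and the work of the
    Lorentz force in the energy equation is, by the momentum equation, the
    derivative of the kinetic energy. Hence the internal energy E - |m|^2 / (2 rho)
    has derivative r |curl H|^2 >= 0 ([heat_content_derive], [joule_heat]). The
    state moves at constant specific volume towards larger e, where s increases
    because ds/de > 0 and ds/de decreases because s is concave; so entropy and
    temperature do not decrease ([entropy_monotone], [second_law]).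

    For the global balance put J = curl H, v = m / rho and
    K = r J - mu v x H + (mu d_i / rho) J x H. The induction equation is
    mu H_t = - curl K, and div (K x H) = H . curl K - K . J. The Hall term of K is
    orthogonal to J, and - mu (v x H) . J = mu (J x H) . v is the power of the
    Lorentz force. The kinetic plus magnetic energy density thus has time
    derivative - div (K x H) - r |J|^2 ([local_balance]). It remains to integrate
    over the cylinder, exchanging the integrals in space and time
    ([swap_space_time]), and to apply the divergence theorem to K x H. The
    division by rho is harmless up to the boundary: rho does not depend on time
    there either, by continuity, and it does not vanish at the initial time.

    The divergence theorem ([gauss_theorem]) is proved for a bounded open set with
    boundary of class C^1. For a field supported in one chart, the shear that
    straightens the graph of g preserves the measure; in the new coordinates the
    divergence is a sum of three partial derivatives, two tangential ones, which
    integrate to zero, and a transverse one, which leaves the flux through the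
    graph ([local_divergence_theorem]). The general case is an induction on a
    finite covering of the closure by cubes contained in charts: a bump function B
    splits F into B F, supported in a chart, and (1 - B) F, for which one cube
    fewer is needed ([gauss_partition]). *)

Set Implicit Arguments.
Unset Strict Implicit.
Unset Printing Implicit Defensive.

Local Open Scope classical_set_scope.
Local Open Scope ring_scope.

(** * Borel sets and Lebesgue measure of space *)

(** Open sets are countable unions of balls centred in a dense sequence with
    rational radii, so measurability of a map into such a space can be tested
    on balls. *)
Lemma measurable_preimage_open d (T : measurableType d) (R : realType)
    (V : pseudoMetricType R) (phi : T -> V) (I : countType) (q : I -> V) :
  (forall x e, 0 < e -> exists i, ball (q i) e x) ->
  (forall x e, measurable (phi @^-1` ball x e)) ->
  forall A, open A -> measurable (phi @^-1` A).
Proof.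
move=> dq mphi A oA.
pose F (c : I * rat) : set T :=
  if `[< ball (q c.1) (ratr c.2) `<=` A >] then phi @^-1` ball (q c.1) (ratr c.2)
  else set0.
rewrite (_ : _ @^-1` _ = \bigcup_c F c).
  apply: countable_bigcupT_measurable => [|c]; first exact: countableP.
  by rewrite /F; case: ifPn.
apply/seteqP; split => [t At|t [c _]]; last first.
  by rewrite /F; case: ifPn => // /asboolP sA /sA.
have /nbhs_ballP[e /= e0 eA] : nbhs (phi t) A by exact: open_nbhs_nbhs.
have [r] := @rat_in_itvoo R 0 (e / 2) ltac:(by rewrite divr_gt0).
rewrite in_itv/= => /andP[r0 re].
have [i qi] := dq (phi t) _ r0.
exists (i, r) => //; rewrite /F /=; case: ifPn => //= /asboolPn.
case=> y qy; apply: eA; apply: (@le_ball _ _ _ (ratr r + ratr r)).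
  by rewrite (splitr e) lerD// ltW.
exact: (ball_triangle (ball_sym qi)).
Qed.

(** Continuity is asked at the points of A but in the ambient topology, which
    is what a smooth extension beyond A provides. The preimage of an open
    interval is, inside A, its interior. *)
Lemma measurable_fun_for_continuous d (T : measurableType d) (R : realType)
    (V : topologicalType) (phi : T -> V) (A : set V) (f : V -> R) :
  (forall O, open O -> measurable (phi @^-1` O)) ->
  (forall x, A x -> {for x, continuous f}) ->
  measurable_fun (phi @^-1` A) (f \o phi).
Proof.
move=> mphi cf mA; apply: (measurability _ (RGenOpens.measurableE R)) => //.
move=> _ [_ [a [b ->]] <-].
rewrite (_ : _ `&` _ = phi @^-1` A `&` phi @^-1` (f @^-1` `]a, b[)^°); last first.
  apply/seteqP; split => t [At ft]; split => //; last exact: interior_subset ft.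
  apply: (cf _ At); apply: open_nbhs_nbhs; split => //; exact: interval_open.
apply: measurableI => //; apply: mphi; exact: open_interior.
Qed.

Section point3_measurable.
Context {R : realType}.

Lemma point3E (p : borel3 R) :
  ((point3 p 0 0 = p.1.1) * (point3 p 0 1 = p.1.2) * (point3 p 0 2 = p.2))%type.
Proof. by rewrite /point3 !mxE. Qed.

Lemma ord3P (P : 'I_3 -> Prop) : P 0 -> P 1 -> P 2 -> forall i, P i.
Proof.
move=> P0 P1 P2; case=> [[|[|[|//]]] i3].
- by rewrite (_ : Ordinal i3 = 0)//; exact: val_inj.
- by rewrite (_ : Ordinal i3 = 1)//; exact: val_inj.
- by rewrite (_ : Ordinal i3 = 2)//; exact: val_inj.
Qed.

Lemma ball_rV3 (x y : 'rV[R]_3) (e : R) : 0 < e ->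
  ball x e y <-> forall i, `|x 0 i - y 0 i| < e.
Proof.
move=> e0; split=> [[_ xy] i|xy]; first exact: xy.
by split=> // i j; rewrite (ord1 i); exact: xy.
Qed.

Lemma rV3_rat_dense (x : 'rV[R]_3) (e : R) : 0 < e ->
  exists i : {ffun 'I_3 -> rat}, ball (\row_j ratr (i j) : 'rV[R]_3) e x.
Proof.
move=> e0.
have h (y : R) : exists q : rat, `|ratr q - y| < e.
  have [q] := @rat_in_itvoo R (y - e) (y + e) ltac:(by rewrite ltrD2l gtrN).
  by rewrite in_itv/= -ltr_distlC distrC; exists q.
have [f hf] := choice (fun j : 'I_3 => h (x 0 j)).
by exists [ffun j => f j]; apply/ball_rV3 => // i; rewrite mxE ffunE.
Qed.

Lemma measurable_point3_ball (x : 'rV[R]_3) e :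
  measurable (@point3 R @^-1` ball x e).
Proof.
have [e0|e0] := ltP 0 e; last first.
  rewrite (_ : _ @^-1` _ = set0)// -subset0 => p [e0'].
  by move: e0; rewrite leNgt e0'.
rewrite (_ : _ @^-1` _ =
   (ball (x 0 0) e `*` ball (x 0 1) e) `*` ball (x 0 2) e).
  apply: measurableX; [apply: measurableX|]; apply: open_measurable;
  exact: ball_open.
apply/seteqP; split => p /=.
  move=> /ball_rV3 /= h.
  have h' := h e0.
  have := (h' 0, h' 1, h' 2).
  rewrite !point3E => -[[a b] c]. by split.
move=> [[h0 h1] h2]; apply/ball_rV3 => //.
by apply: ord3P; rewrite point3E.
Qed.

Lemma measurable_point3 (A : set 'rV[R]_3) :
  open A -> measurable (@point3 R @^-1` A).
Proof.
exact: (measurable_preimage_open rV3_rat_dense measurable_point3_ball).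
Qed.

Lemma measurable_point3_time (A : set ('rV[R]_3 * R)) : open A ->
  measurable ((fun p : borel3 R * measurableTypeR R => (point3 p.1, p.2)) @^-1` A).
Proof.
pose q (i : {ffun 'I_3 -> rat} * rat) : 'rV[R]_3 * R :=
  (\row_j ratr (i.1 j), ratr i.2).
apply: (@measurable_preimage_open _ _ R _ _ _ q).
  move=> [x t] e e0; have [i xi] := rV3_rat_dense x e0.
  have [r] := @rat_in_itvoo R (t - e) (t + e) ltac:(by rewrite ltrD2l gtrN).
  rewrite in_itv/= -ltr_distlC => tr.
  by exists (i, r); split => //=; apply: ball_sym.
move=> [x t] e.
rewrite (_ : _ @^-1` _ = (point3 @^-1` ball x e) `*` ball t e)//.
apply: measurableX; first exact: measurable_point3_ball.
have [e0|e0] := ltP 0 e.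
  by apply: open_measurable; exact: ball_open.
rewrite (_ : ball _ _ = set0) // -subset0 => s.
rewrite /ball/= => /lt_le_trans /(_ e0).
by rewrite normr_lt0.
Qed.
End point3_measurable.

Section lebesgue3_invariance.
Context {R : realType}.
Local Notation mu1 := (@lebesgue_measure R).
Local Notation mu2 := (@lebesgue2 R).
Local Notation mu3 := (@lebesgue3 R).
(** The volume-preserving chart that straightens the graph of g: the
    half-space where the last coordinate has a given sign goes to one side of
    the graph. *)
Definition shear (k : 'I_3) (g : R * R -> R) (p : borel3 R) : 'rV[R]_3 :=
  graph_point k (fun y => g y + p.2) p.1.

Lemma point3K (x : 'rV[R]_3) : point3 ((x 0 0, x 0 1), x 0 2) = x.
Proof. by apply/rowP; apply: ord3P; rewrite point3E. Qed.

(** Borel maps on row vectors are maps whose composition with the coordinate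
    parametrisation is measurable; this lets them be composed with any map
    given by its coordinates. *)
Lemma measurable_fun_coord d d' (T : measurableType d) (T' : measurableType d')
    (f : 'rV[R]_3 -> T') (psi : T -> 'rV[R]_3) :
  measurable_fun setT (f \o @point3 R) ->
  (forall i, measurable_fun setT (fun t => psi t 0 i : measurableTypeR R)) ->
  measurable_fun setT (f \o psi).
Proof.
move=> mf mpsi.
rewrite (_ : f \o psi = (f \o @point3 R) \o
    (fun t => ((psi t 0 0, psi t 0 1), psi t 0 2))); last first.
  by apply/funext => t /=; rewrite point3K.
apply: (measurableT_comp mf).
by apply: measurable_fun_pair => //; exact: measurable_fun_pair.
Qed.

Lemma measurable_shear k g i :
  measurable_fun [set: measurableTypeR R * measurableTypeR R] g ->
  measurable_fun setT (fun p => shear k g p 0 i : measurableTypeR R).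
Proof.
move=> mg; rewrite (_ : (fun _ => _) = fun p => if i == k then g p.1 + p.2
    else if i == k + 1 then p.1.1 else p.1.2); last first.
  by apply/funext => p; rewrite /shear /graph_point mxE.
case: (i == k).
  by apply: measurable_funD => //; exact: (measurableT_comp mg).
by case: (i == k + 1); exact: measurableT_comp.
Qed.

Local Open Scope ereal_scope.

(** The translate of Lebesgue measure gives every half-open interval its
    length, and those lengths determine the measure. *)
Lemma ge0_integral_translate (f : measurableTypeR R -> \bar R) (c : R) :
  measurable_fun setT f -> (forall z, 0 <= f z) ->
  \int[mu1]_z f z = \int[mu1]_z f (c + z)%R.
Proof.
move=> mf f0.
have mc : measurable_fun [set: measurableTypeR R]
    (fun z => (c + z)%R : measurableTypeR R).
  exact: measurable_funD.
have E (A : set (measurableTypeR R)) : measurable A ->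
    mu1 A = pushforward mu1 (fun z => (c + z)%R : measurableTypeR R) A.
  apply: lebesgue_measure_unique => _ [[a b]] _ <-.
  rewrite /= /pushforward (_ : _ @^-1` _ = `](a - c)%R, (b - c)%R]%classic).
    rewrite !lebesgue_measure_itv/= !lte_fin ltrD2r.
    by case: ifPn => // _; rewrite -!EFinD; congr (_%:E); ring.
  by apply/seteqP; split=> z /=; rewrite !in_itv/= ltrBlDl lerBrDl.
transitivity (\int[pushforward mu1 (fun z => (c + z)%R : measurableTypeR R)]_z f z).
  by apply: eq_measure_integral => A mA _; exact: E.
by rewrite (ge0_integral_pushforward mc).
Qed.

(** By Tonelli the innermost variable may be moved outside, which is a cyclic
    permutation of the axes. *)
Lemma ge0_integral_rotate (f : borel3 R -> \bar R) :
  measurable_fun setT f -> (forall p, 0 <= f p) ->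
  \int[mu3]_p f p = \int[mu3]_p f ((p.2, p.1.1), p.1.2).
Proof.
move=> mf f0.
have mrot : measurable_fun [set: borel3 R]
    (fun p : borel3 R => ((p.2, p.1.1), p.1.2) : borel3 R).
  apply: measurable_fun_pair; first apply: measurable_fun_pair => //=.
    exact: measurableT_comp.
  exact: measurableT_comp.
rewrite (fubini_tonelli1 f)//=.
rewrite fubini_tonelli1//=; last 2 first.
  exact: measurable_fun_fubini_tonelli_F.
  by move=> y; apply: integral_ge0.
rewrite (fubini_tonelli2 (fun p : borel3 R => f ((p.2, p.1.1), p.1.2)))//=; last first.
  exact: (measurableT_comp mf mrot).
apply: eq_integral => a _; rewrite /fubini_F /fubini_G /=.
rewrite (fubini_tonelli1 (fun y : measurableTypeR R * measurableTypeR R => f ((a, y.1), y.2)))//=.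
apply: (measurableT_comp mf).
by apply: measurable_fun_pair => //; exact: measurable_fun_pair.
Qed.

Lemma tonelli3 (f : borel3 R -> \bar R) :
  measurable_fun setT f -> (forall p, 0 <= f p) ->
  \int[mu3]_p f p = \int[mu2]_y \int[mu1]_z f (y, z).
Proof. by move=> mf f0; exact: fubini_tonelli1. Qed.

(** A cyclic permutation of the axes brings the coordinate k last; the shear
    is then, on each vertical line, a translation. *)
Lemma ge0_integral_shear (k : 'I_3) (g : R * R -> R) (f : 'rV[R]_3 -> \bar R) :
  measurable_fun [set: measurableTypeR R * measurableTypeR R] g ->
  measurable_fun setT (f \o @point3 R) -> (forall x, 0 <= f x) ->
  \int[mu3]_p f (point3 p) = \int[mu3]_p f (shear k g p).
Proof.
move=> mg mf f0.
have mfs g' : measurable_fun [set: measurableTypeR R * measurableTypeR R] g' ->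
    measurable_fun setT (f \o shear k g').
  by move=> mg'; apply: measurable_fun_coord => // i; exact: measurable_shear.
have mrot (h : borel3 R -> \bar R) : measurable_fun setT h ->
    measurable_fun setT (fun p : borel3 R => h ((p.2, p.1.1), p.1.2)).
  move=> mh; apply: (measurableT_comp mh).
  apply: measurable_fun_pair; first apply: measurable_fun_pair => //=.
    exact: measurableT_comp.
  exact: measurableT_comp.
transitivity (\int[mu3]_p f (shear k (cst 0%R) p)).
  move: k {mfs}; apply: ord3P.
  - rewrite (ge0_integral_rotate mf)//=; apply: eq_integral => p _; congr f.
    by apply/rowP; apply: ord3P; rewrite point3E mxE/= ?add0r.
  - rewrite (ge0_integral_rotate mf)//= (ge0_integral_rotate (mrot _ mf))//=.
    apply: eq_integral => p _; congr f.
    by apply/rowP; apply: ord3P; rewrite point3E mxE/= ?add0r.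
  - apply: eq_integral => p _; congr f.
    by apply/rowP; apply: ord3P; rewrite point3E mxE/= ?add0r.
have f0s g' p : 0 <= (f \o shear k g') p by exact: f0.
have m0 : measurable_fun [set: measurableTypeR R * measurableTypeR R]
    (cst (0%R : R)) by exact: measurable_cst.
rewrite [LHS](tonelli3 (mfs _ m0) (f0s _)).
rewrite [RHS](tonelli3 (mfs _ mg) (f0s _)).
apply: eq_integral => y _ /=.
rewrite (ge0_integral_translate (g y)) //=; last first.
  by apply: (measurableT_comp (mfs _ _)) => //; exact: measurable_pair1.
apply: eq_integral => z _; congr f.
by apply/rowP => i; rewrite !mxE /= add0r.
Qed.

Lemma integral_shear (k : 'I_3) (g : R * R -> R) (f : 'rV[R]_3 -> R) :
  measurable_fun [set: measurableTypeR R * measurableTypeR R] g ->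
  measurable_fun setT (f \o @point3 R) ->
  \int[mu3]_p (f (point3 p))%:E = \int[mu3]_p (f (shear k g p))%:E.
Proof.
move=> mg mf; rewrite [LHS]integralE [RHS]integralE.
have mfE : measurable_fun setT (fun p => (f (point3 p))%:E).
  exact/measurable_EFinP.
have Ep : \int[mu3]_p (EFin \o f)^\+ (point3 p) =
          \int[mu3]_p (EFin \o f)^\+ (shear k g p).
  apply: (@ge0_integral_shear k g ((EFin \o f)^\+)) => //.
  by rewrite -funepos_comp; exact: (measurable_funepos mfE).
have En : \int[mu3]_p (EFin \o f)^\- (point3 p) =
          \int[mu3]_p (EFin \o f)^\- (shear k g p).
  apply: (@ge0_integral_shear k g ((EFin \o f)^\-)) => //.
  by rewrite -funeneg_comp; exact: (measurable_funeneg mfE).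
have pE (h : borel3 R -> 'rV[R]_3) :
    (fun p => (f (h p))%:E)^\+ = (EFin \o f)^\+ \o h.
  by rewrite -funepos_comp.
have nE (h : borel3 R -> 'rV[R]_3) :
    (fun p => (f (h p))%:E)^\- = (EFin \o f)^\- \o h.
  by rewrite -funeneg_comp.
congr (_ - _).
  by rewrite (pE (@point3 R)) (pE (shear k g)); exact: Ep.
by rewrite (nE (@point3 R)) (nE (shear k g)); exact: En.
Qed.

Lemma integrable_shear (k : 'I_3) (g : R * R -> R) (f : 'rV[R]_3 -> R) :
  measurable_fun [set: measurableTypeR R * measurableTypeR R] g ->
  measurable_fun setT (f \o @point3 R) ->
  mu3.-integrable setT (fun p => (f (shear k g p))%:E) ->
  mu3.-integrable setT (fun p => (f (point3 p))%:E).
Proof.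
move=> mg mf /integrableP[mfs ifs]; apply/integrableP; split.
  exact/measurable_EFinP.
have E := @ge0_integral_shear k g (fun x => `|(f x)%:E|) mg.
rewrite E//; have mfE : measurable_fun setT (EFin \o (f \o @point3 R)).
  exact/measurable_EFinP.
exact: (measurableT_comp _ mfE).
Qed.

End lebesgue3_invariance.

(** * Functions of class C^1 near a point *)

Section c1.
Context {R : realType}.
Implicit Types U V W : normedModType R.

(** The pointwise form of being of class C^1. Directions v range over the
    whole space, so in finite dimension the last clause says that the
    differential is continuous at x. *)
Definition c1 V W (f : V -> W) (x : V) : Prop :=
  (\forall y \near x, differentiable f y) /\
  forall v, {for x, continuous ('D_v f)}.

Lemma c1_differentiable V W (f : V -> W) x : c1 f x -> differentiable f x.
Proof. by move=> [/nbhs_singleton]. Qed.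

Lemma c1_continuous V W (f : V -> W) x : c1 f x -> {for x, continuous f}.
Proof. by move=> /c1_differentiable /differentiable_continuous. Qed.

Lemma near_continuous (T S : topologicalType) (f : T -> S) (x : T) (P : S -> Prop) :
  {for x, continuous f} -> (\forall z \near f x, P z) -> \forall y \near x, P (f y).
Proof. by move=> cf Pf; exact: cf. Qed.

Lemma for_continuous_comp (S T T' : topologicalType) (f : S -> T) (h : T -> T') x :
  {for x, continuous f} -> {for f x, continuous h} ->
  {for x, continuous (fun y => h (f y))}.
Proof. by move=> cf ch; exact: continuous_comp. Qed.

Lemma for_continuousD (T : topologicalType) (f g : T -> R) x :
  {for x, continuous f} -> {for x, continuous g} ->
  {for x, continuous (fun y => f y + g y)}.
Proof. by move=> cf cg; exact: cvgD. Qed.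

Lemma for_continuousN (T : topologicalType) (f : T -> R) x :
  {for x, continuous f} -> {for x, continuous (fun y => - f y)}.
Proof. by move=> cf; exact: cvgN. Qed.

Lemma for_continuousM (T : topologicalType) (f g : T -> R) x :
  {for x, continuous f} -> {for x, continuous g} ->
  {for x, continuous (fun y => f y * g y)}.
Proof. by move=> cf cg; exact: cvgM. Qed.

Lemma for_continuousV (T : topologicalType) (f : T -> R) x : f x != 0 ->
  {for x, continuous f} -> {for x, continuous (fun y => (f y)^-1)}.
Proof. by move=> f0 cf; exact: cvgV. Qed.

Lemma Ck1_c1 V W (A : set V) (f : V -> W) :
  open A -> Ck 1 A f -> forall x, A x -> c1 f x.
Proof.
move=> oA [df cf] x Ax; split; last by move=> v; exact: cf.
by apply: filterS (open_nbhs_nbhs (conj oA Ax)) => y; exact: df.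
Qed.

(** Differentiability at x only sees the germ of the function, because it is
    an expansion at x. *)
Lemma near_eq_differentiable V W (f g : V -> W) x :
  (\forall y \near x, f y = g y) -> differentiable f x -> differentiable g x.
Proof.
move=> fg dfx; have fgx := nbhs_singleton fg.
have [cf fE] := (diff_locallyP x f).1 dfx.
have gE : g \o shift x = cst (g x) + 'd f x +o_ 0 id.
  apply/eqaddoP => e e0.
  move/eqaddoP: fE => /(_ e e0) fE.
  have fg0 : \forall y \near 0, f (y + x) = g (y + x).
    by move: fg; rewrite (near_shift 0 x); apply: filterS => y /=; rewrite subr0.
  by apply: filterS2 fE fg0 => y; rewrite -![(_ - _) y]/(_ y - _ y) /= !fctE /= -fgx => + <-.
have dE := diff_unique cf gE.
by apply/diff_locallyP; rewrite dE.
Qed.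

Lemma derive_comp U V W (A : U -> V) (f : V -> W) x v :
  differentiable A x -> differentiable f (A x) ->
  'D_v (f \o A) x = 'D_('D_v A x) f (A x).
Proof.
move=> dA df; rewrite deriveE; last exact: differentiable_comp.
by rewrite diff_comp//= -!deriveE.
Qed.

Lemma derive_lincomb V W (f : V -> W) x (a : R) u w :
  differentiable f x -> 'D_(a *: u + w) f x = a *: 'D_u f x + 'D_w f x.
Proof. by move=> df; rewrite !deriveE// linearP. Qed.

Lemma derive_coord n V (F : V -> 'rV[R]_n) x v i :
  differentiable F x -> 'D_v (fun y => F y 0 i) x = 'D_v F x 0 i.
Proof.
move=> dF.
have @L : {linear 'rV[R]_n -> R}.
  by exists (fun N : 'rV[R]_n => N 0 i); do 2![eexists]; do ?[constructor];
     rewrite ?mxE// => ? *; rewrite ?mxE//; move=> ?; rewrite !mxE.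
have cL : continuous L by exact: coord_continuous.
rewrite (_ : (fun y => F y 0 i) = L \o F)//.
rewrite deriveE; last exact/differentiable_comp/linear_differentiable.
rewrite diff_comp//; last exact/linear_differentiable.
have -> : ('d L (F x) : 'rV[R]_n -> R) = L by exact: diff_lin.
by rewrite /= -deriveE.
Qed.

Lemma near_eq_c1 V W (f g : V -> W) x :
  (\forall y \near x, f y = g y) -> c1 f x -> c1 g x.
Proof.
move=> fg [df cf]; have fg2 : \forall z \near x, \forall y \near z, f y = g y.
  exact: near_join.
split; first by apply: filterS2 df fg2 => y dfy fgy; exact: near_eq_differentiable dfy.
move=> v; have e : \forall z \near x, 'D_v f z = 'D_v g z.
  by apply: filterS fg2 => z; exact: near_eq_derive.
have ex := nbhs_singleton e.
rewrite /prop_for /continuous_at -ex.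
exact: cvg_trans (near_eq_cvg e) (cf v).
Qed.

(** Membership in the class is established from a formula for the derivatives
    near x; all closure properties below are instances. *)
Lemma c1_from V W (f : V -> W) (df : V -> V -> W) x :
  (\forall y \near x, differentiable f y) ->
  (forall v, \forall y \near x, 'D_v f y = df v y) ->
  (forall v, {for x, continuous (df v)}) -> c1 f x.
Proof.
move=> d e c; split => // v; have ex := nbhs_singleton (e v).
rewrite /prop_for /continuous_at ex.
apply: cvg_trans (c v); apply: near_eq_cvg.
by apply: filterS (e v) => y ->.
Qed.

Lemma c1_cst V W (a : W) (x : V) : c1 (cst a) x.
Proof.
apply: (@c1_from _ _ _ (fun _ _ => 0)).
- by apply: nearW => y; exact: differentiable_cst.
- by move=> v; apply: nearW => y; rewrite derive_cst.
- by move=> v; exact: cst_continuous.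
Qed.

Lemma c1D V W (f g : V -> W) x : c1 f x -> c1 g x -> c1 (fun y => f y + g y) x.
Proof.
move=> [df cf] [dg cg]; apply: (@c1_from _ _ _ (fun v y => 'D_v f y + 'D_v g y)).
- by apply: filterS2 df dg => y; exact: differentiableD.
- move=> v; apply: filterS2 df dg => y dfy dgy.
  by rewrite (@deriveD _ _ _ f g)//; exact: diff_derivable.
- by move=> v; apply: continuousD.
Qed.

Lemma c1Z V W (f : V -> W) (a : R) x : c1 f x -> c1 (fun y => a *: f y) x.
Proof.
move=> [df cf]; apply: (@c1_from _ _ _ (fun v y => a *: 'D_v f y)).
- by apply: filterS df => y; exact: differentiableZ.
- move=> v; apply: filterS df => y dfy.
  by rewrite (@deriveZ _ _ _ f)//; exact: diff_derivable.
- by move=> v; exact: (for_continuous_comp (cf v) (@scaler_continuous _ _ a _)).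
Qed.

Lemma c1N V W (f : V -> W) x : c1 f x -> c1 (fun y => - f y) x.
Proof.
move=> /(@c1Z _ _ _ (- 1)); apply: near_eq_c1; apply: nearW => y.
by rewrite scaleN1r.
Qed.

Lemma c1B V W (f g : V -> W) x : c1 f x -> c1 g x -> c1 (fun y => f y - g y) x.
Proof. by move=> cf /c1N; exact: c1D. Qed.

Lemma c1M V (f g : V -> R) x : c1 f x -> c1 g x -> c1 (fun y => f y * g y) x.
Proof.
move=> [df cf] [dg cg].
apply: (@c1_from _ _ _ (fun v y => f y * 'D_v g y + g y * 'D_v f y)).
- by apply: filterS2 df dg => y; exact: differentiableM.
- move=> v; apply: filterS2 df dg => y dfy dgy.
  by rewrite (@deriveM _ _ f g)//; exact: diff_derivable.
- have := differentiable_continuous (nbhs_singleton df).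
  have := differentiable_continuous (nbhs_singleton dg).
  by move=> cg0 cf0 v; apply: for_continuousD; apply: for_continuousM.
Qed.

Lemma c1_comp V (h : R -> R) (f : V -> R) x :
  c1 h (f x) -> c1 f x -> c1 (h \o f) x.
Proof.
move=> [dh ch] [df cf].
have cfx := differentiable_continuous (nbhs_singleton df).
have dh' : \forall y \near x, differentiable h (f y).
  exact: (near_continuous cfx dh).
apply: (@c1_from _ _ _ (fun v y => 'D_v f y * 'D_1 h (f y))).
- by apply: filterS2 df dh' => y; exact: differentiable_comp.
- move=> v; apply: filterS2 df dh' => y dfy dhy.
  rewrite derive_comp//.
  rewrite -[in LHS](addr0 ('D_v f y)) -[X in 'D_(X + _) h _ = _](mulr1 ('D_v f y)).
  by rewrite derive_lincomb// derive0 addr0.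
- move=> v; apply: for_continuousM; first exact: cf.
  exact: (for_continuous_comp cfx (ch _)).
Qed.

Lemma near_neq0 (T : topologicalType) (f : T -> R) x :
  f x != 0 -> {for x, continuous f} -> \forall y \near x, f y != 0.
Proof.
move=> fx0 cfx; apply: (near_continuous cfx (P := fun z => z != 0)).
apply: (@open_nbhs_nbhs _ (f x) (fun z => is_true (z != 0))); split => //.
Qed.

Lemma c1V V (f : V -> R) x : f x != 0 -> c1 f x -> c1 (fun y => (f y)^-1) x.
Proof.
move=> fx0 [df cf]; have cfx := differentiable_continuous (nbhs_singleton df).
have f0 := near_neq0 fx0 cfx.
apply: (@c1_from _ _ _ (fun v y => - (f y) ^- 2 * 'D_v f y)).
- by apply: filterS2 df f0 => y; exact: differentiableV.
- move=> v; apply: filterS2 df f0 => y dfy fy0.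
  by rewrite deriveV//; exact: diff_derivable.
- move=> v; apply: for_continuousM; last exact: cf.
  apply: for_continuousN; apply: for_continuousV; first by rewrite expf_neq0.
  by rewrite /GRing.exp /=; exact: for_continuousM.
Qed.

Lemma c1_coord n V (F : V -> 'rV[R]_n) x i : c1 F x -> c1 (fun y => F y 0 i) x.
Proof.
move=> [dF cF]; apply: (@c1_from _ _ _ (fun v y => 'D_v F y 0 i)).
- apply: filterS dF => y dFy.
  exact: (@differentiable_comp _ _ _ _ F (fun N : 'rV[R]_n => N 0 i) y dFy (differentiable_coord _ _ _)).
- by move=> v; apply: filterS dF => y; exact: derive_coord.
- by move=> v; exact: (for_continuous_comp (cF v) (@coord_continuous _ _ _ 0 i _)).
Qed.

Lemma c1_id V (x : V) : c1 id x.
Proof.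
apply: (@c1_from _ _ _ (fun v _ => v)).
- by apply: nearW => y.
- by move=> v; apply: nearW => y; rewrite derive_id.
- by move=> v; exact: cst_continuous.
Qed.

Lemma derive_pair U V W (A : U -> V) (B : U -> W) x v :
  differentiable A x -> differentiable B x ->
  'D_v (fun y => (A y, B y)) x = ('D_v A x, 'D_v B x).
Proof.
move=> dA dB; rewrite deriveE; last exact: differentiable_pair.
by rewrite (diff_pair dA dB) !deriveE.
Qed.

(** Freezing the time variable is a composition with a map whose derivative is
    constant. *)
Lemma derive_slice V W (F : V * R -> W) x t v : differentiable F (x, t) ->
  'D_v (fun y => F (y, t)) x = 'D_(v, 0) F (x, t).
Proof.
move=> dF; rewrite (@derive_comp _ _ _ (fun y => (y, t)) F)//.
by rewrite (@derive_pair _ _ _ id (cst t))// derive_id derive_cst.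
Qed.

Lemma derive1_slice V W (F : V * R -> W) x t : differentiable F (x, t) ->
  derivable (fun s => F (x, s)) t 1 /\
  derive1 (fun s => F (x, s)) t = 'D_(0, 1) F (x, t).
Proof.
move=> dF; split.
  apply: diff_derivable.
  by apply: (@differentiable_comp _ _ _ _ (fun s => (x, s)) F).
rewrite derive1E (@derive_comp _ _ _ (fun s => (x, s)) F)//.
by rewrite (@derive_pair _ _ _ (cst x) id)// derive_id derive_cst.
Qed.

Lemma slice_continuous (T S : topologicalType) (t : S) : continuous (fun y : T => (y, t)).
Proof. by move=> y; apply: cvg_pair; [exact: cvg_id|exact: cvg_cst]. Qed.

Lemma for_continuous_slice (S T T' : topologicalType) (h : S * T -> T') x t :
  {for (x, t), continuous h} -> {for x, continuous (fun x => h (x, t))}.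
Proof. by move=> ch; apply: continuous_comp ch; exact: slice_continuous. Qed.

Lemma for_continuous_slice2 (S T T' : topologicalType) (h : S * T -> T') x t :
  {for (x, t), continuous h} -> {for t, continuous (fun t => h (x, t))}.
Proof.
move=> ch; apply: (@continuous_comp _ _ _ (fun t => (x, t)) h) ch.
by apply: cvg_pair; [exact: cvg_cst|exact: cvg_id].
Qed.

Lemma c1_slice V W (F : V * R -> W) x t : c1 F (x, t) -> c1 (fun y => F (y, t)) x.
Proof.
move=> [dF cF].
have dF' := near_continuous (@slice_continuous _ _ t x) dF.
apply: (@c1_from _ _ _ (fun v y => 'D_(v, 0) F (y, t))).
- apply: filterS dF' => y dFy.
  by apply: (@differentiable_comp _ _ _ _ (fun y => (y, t)) F).
- by move=> v; apply: filterS dF' => y; exact: derive_slice.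
by move=> v; exact: (for_continuous_comp (@slice_continuous _ _ t x) (cF _)).
Qed.

End c1.

(** * Integrals of compactly supported functions over a half-space *)

Lemma integrable_compact_support d (T : measurableType d) (R : realType)
    (mu : {measure set T -> \bar R}) (V : topologicalType) (phi : T -> V)
    (K : set V) (f : V -> R) :
  (forall A, open A -> measurable (phi @^-1` A)) ->
  compact K -> closed K -> (mu (phi @^-1` K) < +oo)%E ->
  continuous f -> (forall x, ~ K x -> f x = 0) ->
  mu.-integrable setT (fun t => (f (phi t))%:E).
Proof.
move=> mphi cK clK muK cf f0.
have mK : measurable (phi @^-1` K).
  rewrite -[phi @^-1` K]setCK; apply: measurableC; rewrite preimage_setC.
  by apply: (mphi (~` K)); exact: closed_openC.
have mf : measurable_fun [set: T] (f \o phi).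
  have := measurable_fun_for_continuous mphi (A := setT) (fun x _ => cf x).
  by rewrite preimage_setT.
have iK : mu.-integrable (phi @^-1` K) (EFin \o (f \o phi)).
  apply: measurable_bounded_integrable => //; first exact: measurable_funTS.
  have cfK : compact (f @` K).
    by apply: continuous_compact => //; exact: continuous_subspaceT.
  have [M [Mr hM]] := compact_bounded cfK.
  exists M; split => // x Mx t Kt; apply: (hM _ Mx).
  by exists (phi t).
move/(integrable_mkcond _ mK) : iK.
congr (_.-integrable _ _); apply/funext => t; rewrite patchE/=.
case: ifPn => // /negP Kt; rewrite f0// => Kt'; apply: Kt.
by rewrite inE.
Qed.

Section Fubini3.
Context {R : realType}.
Local Notation mu1 := (@lebesgue_measure R).
Local Notation mu2 := (@lebesgue2 R).
Local Notation mu3 := (@lebesgue3 R).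
Local Notation m1 := (measurableTypeR R).
Local Open Scope ereal_scope.

Lemma fubini3_12 (f : borel3 R -> \bar R) : mu3.-integrable setT f ->
  \int[mu3]_p f p = \int[mu2]_y \int[mu1]_z f (y, z).
Proof. by move=> fi; rewrite -(integral12_prod_meas1 fi). Qed.

Lemma fubini3_21 (f : borel3 R -> \bar R) : mu3.-integrable setT f ->
  \int[mu3]_p f p = \int[mu1]_z \int[mu2]_y f (y, z).
Proof. by move=> fi; rewrite -(integral21_prod_meas1 fi). Qed.

Lemma fubini2_12 (f : m1 * m1 -> \bar R) : mu2.-integrable setT f ->
  \int[mu2]_p f p = \int[mu1]_y \int[mu1]_z f (y, z).
Proof. by move=> fi; rewrite -(integral12_prod_meas1 fi). Qed.

Lemma fubini2_21 (f : m1 * m1 -> \bar R) : mu2.-integrable setT f ->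
  \int[mu2]_p f p = \int[mu1]_z \int[mu1]_y f (y, z).
Proof. by move=> fi; rewrite -(integral21_prod_meas1 fi). Qed.

End Fubini3.

Section compact_support.
Context {R : realType}.
Local Notation mu1 := (@lebesgue_measure R).
Local Notation mu2 := (@lebesgue2 R).
Local Notation mu3 := (@lebesgue3 R).
Local Notation m1 := (measurableTypeR R).

(** The form taken by the side condition of a chart when g = 0; b selects the
    half-line. *)
Definition half_line (b : bool) : set R := [set z | 0 < (-1) ^+ b * - z].

Lemma half_lineE b : half_line b = if b then [set` `]0, +oo[] else [set` `]-oo, 0[].
Proof.
rewrite /half_line; case: b; apply/seteqP; split => z /=; rewrite in_itv/= ?andbT ?expr1 ?expr0; lra.
Qed.

Lemma measurable_half_line b : measurable (half_line b : set m1).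
Proof. by rewrite half_lineE; case: b; exact: measurable_itv. Qed.

Variables (phi dphi : R -> R) (M : R).
Hypothesis dphiE : forall z : R, is_derive z 1 phi (dphi z).
Hypothesis cdphi : continuous dphi.
Hypothesis phi0 : forall z, M < `|z| -> phi z = 0.

(** Where the function vanishes in a neighbourhood, so does its derivative. *)
Lemma derive_compact_support z : M < `|z| -> dphi z = 0.
Proof.
move=> Mz; have <- := @derive_val _ _ _ _ _ _ _ (dphiE z).
rewrite (@near_eq_derive _ _ _ _ (cst 0)) ?derive_cst//.
have : \forall y \near z, M < `|y|.
  apply: (near_continuous (P := fun y => M < y) (f := fun y : R => `|y|)).
    exact: norm_continuous.
  exact: lt_nbhsr.
by apply: filterS => y; exact: phi0.
Qed.

Lemma FTC_itv (a b : R) : a < b ->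
  (\int[mu1]_(z in `[a, b]) (dphi z)%:E = (phi b - phi a)%:E)%E.
Proof.
move=> ab; rewrite (continuous_FTC2 (F := phi) ab) ?EFinB//.
- exact: continuous_subspaceT.
- have c z : {for z, continuous phi}.
    by apply: differentiable_continuous; apply/derivable1_diffP; have [] := dphiE z.
  split.
  + by move=> z _; have [] := dphiE z.
  + by apply: cvg_at_right_filter; exact: c.
  + by apply: cvg_at_left_filter; exact: c.
- by move=> z _; rewrite derive1E; apply: derive_val.
Qed.

Lemma FTC_compact_support : (\int[mu1]_z (dphi z)%:E = 0)%E.
Proof.
(* M may be negative, hence the absolute value. *)
pose N : R := `|M| + 1.
have N0 : - N < N by have := normr_ge0 M; rewrite /N; lra.
have MN (z : R) : z \notin `[- N, N] -> M < `|z|.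
  rewrite in_itv/= -ler_norml -ltNge; apply: lt_trans.
  by rewrite (le_lt_trans (ler_norm M))// /N ltrDl.
transitivity (\int[mu1]_(z in `[(- N)%R, N]) (dphi z)%:E)%E.
  rewrite [RHS]integral_mkcond; apply: eq_integral => z _; rewrite patchE.
  case: ifPn => //; rewrite mem_setE => /MN zM.
  by rewrite derive_compact_support.
have hN : M < `|N|.
  by rewrite (le_lt_trans (ler_norm M))// [`|N|]ger0_norm ?ltrDl// addr_ge0.
by rewrite FTC_itv// !phi0 ?subrr// normrN.
Qed.

(** The sign is that of the outward normal at the endpoint 0: the half-line is
    z < 0 if b is false and z > 0 otherwise. *)
Lemma FTC_half_line (b : bool) :
  (\int[mu1]_(z in half_line b) (dphi z)%:E = ((-1) ^+ b * phi 0)%:E)%E.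
Proof.
pose N : R := `|M| + 1.
have N0 : 0 < N by have := normr_ge0 M; rewrite /N; lra.
have MN (z : R) : N <= `|z| -> M < `|z|.
  by move=> h; rewrite (le_lt_trans (ler_norm M))// (lt_le_trans _ h)// /N ltrDl.
have mdphi D : measurable_fun (D : set R) (EFin \o dphi).
  by apply/measurable_EFinP/measurable_funTS; exact: continuous_measurable_fun.
case: b; rewrite half_lineE ?expr0 ?expr1.
  transitivity (\int[mu1]_(z in `]0%R, N]) (dphi z)%:E)%E.
    rewrite [LHS]integral_mkcond [RHS]integral_mkcond.
    apply: eq_integral => z _; rewrite !patchE !mem_setE !in_itv/= andbT.
    case: ltP => //= z0; case: leP => // Nz.
    by rewrite derive_compact_support//; apply: MN; rewrite gtr0_norm// ltW.
  rewrite integral_itv_obnd_cbnd// FTC_itv//; congr (_%:E).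
  by rewrite phi0 ?sub0r ?mulN1r//; apply: MN; exact: ler_norm.
transitivity (\int[mu1]_(z in `[(- N)%R, 0%R[) (dphi z)%:E)%E.
  rewrite [LHS]integral_mkcond [RHS]integral_mkcond.
  apply: eq_integral => z _; rewrite !patchE !mem_setE !in_itv/=.
  rewrite andbC; case: ltP => //= z0; case: leP => // Nz.
  rewrite derive_compact_support//; apply: MN; rewrite ltr0_norm//; lra.
rewrite integral_itv_bndo_bndc//.
rewrite FTC_itv; last by rewrite oppr_lt0.
rewrite [phi (- N)]phi0 ?subr0 ?mul1r//; apply: MN; rewrite normrN; exact: ler_norm.
Qed.

End compact_support.

Section flat_divergence.
Context {R : realType}.
Local Notation mu1 := (@lebesgue_measure R).
Local Notation mu2 := (@lebesgue2 R).
Local Notation mu3 := (@lebesgue3 R).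
Local Notation m1 := (measurableTypeR R).

Definition box (M : R) : set 'rV[R]_3 := [set x | forall i, `|x 0 i| <= M].

Lemma compact_box M : compact (box M).
Proof.
rewrite (_ : box M = [set x : 'rV[R]_3 | forall i, (`[- M, M]%classic : set R) (x ord0 i)]).
  apply: (@rV_compact _ 3 (fun=> `[- M, M]%classic)) => i.
  exact: segment_compact.
by apply/seteqP; split => x /= h i; have := h i; rewrite /= in_itv/= -ler_norml.
Qed.

Lemma closed_box M : closed (box M).
Proof. by apply: compact_closed; [exact: norm_hausdorff|exact: compact_box]. Qed.

Lemma lebesgue2X (A B : set m1) : measurable A -> measurable B ->
  mu2 (A `*` B) = (mu1 A * mu1 B)%E.
Proof. exact: product_measure1E. Qed.

Lemma lebesgue3X (A B C : set m1) : measurable A -> measurable B -> measurable C ->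
  mu3 ((A `*` B) `*` C) = (mu1 A * mu1 B * mu1 C)%E.
Proof.
move=> mA mB mC; rewrite -lebesgue2X//.
by apply: product_measure1E => //; exact: measurableX.
Qed.

Let box_preimage M : @point3 R @^-1` box M = (`[- M, M] `*` `[- M, M]) `*` `[- M, M].
Proof.
apply/seteqP; split=> p /=.
  by move=> h; have := (h 0, h 1, h 2); rewrite !point3E !in_itv/= -!ler_norml => -[[]].
rewrite !in_itv/= -!ler_norml => -[[h0 h1] h2].
by apply: ord3P; rewrite point3E.
Qed.

Lemma measurable_box M : measurable (@point3 R @^-1` box M).
Proof. by rewrite box_preimage; do 2?apply: measurableX => //; exact: measurable_itv. Qed.

Lemma lebesgue3_box M : (mu3 (@point3 R @^-1` box M) < +oo)%E.
Proof.
have mI : measurable (`[- M, M]%classic : set m1) by exact: measurable_itv.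
rewrite box_preimage [X in (X < _)%E](lebesgue3X mI mI mI).
rewrite !lebesgue_measure_itv/=.
by case: ifPn => _; rewrite ?mule0 ?mul0e ?ltry// -!EFinD -!EFinM ltry.
Qed.

Lemma integrable_box (f : 'rV[R]_3 -> R) M : continuous f ->
  (forall x, ~ box M x -> f x = 0) ->
  mu3.-integrable setT (fun p => (f (point3 p))%:E).
Proof.
move=> cf f0; apply: (integrable_compact_support (K := box M)) => //.
- exact: measurable_point3.
- exact: compact_box.
- exact: closed_box.
- exact: lebesgue3_box.
Qed.

Lemma measurable_square_open (A : set (R * R)) : open A ->
  measurable ((fun y : m1 * m1 => y : R * R) @^-1` A).
Proof.
  pose q (i : rat * rat) : R * R := (ratr i.1, ratr i.2).
  apply: (@measurable_preimage_open _ _ R _ _ _ q).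
    move=> [x t] e e0.
    have [r1] := @rat_in_itvoo R (x - e) (x + e) ltac:(by rewrite ltrD2l gtrN).
    have [r2] := @rat_in_itvoo R (t - e) (t + e) ltac:(by rewrite ltrD2l gtrN).
    rewrite !in_itv/= -!ltr_distlC => h2 h1.
    by exists (r1, r2); split => /=; apply: ball_sym.
  move=> [x t] e.
  rewrite (_ : _ @^-1` _ = ball x e `*` ball t e)//.
  have mb (z : R) : measurable (ball z e : set m1).
    have [e0|e0] := ltP 0 e.
      by apply: open_measurable; exact: ball_open.
    rewrite (_ : ball _ _ = set0) // -subset0 => w.
    by rewrite /ball/= => /lt_le_trans /(_ e0); rewrite normr_lt0.
  exact: measurableX.
Qed.

Lemma measurable_square (f : R * R -> R) : continuous f ->
  measurable_fun [set: m1 * m1] f.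
Proof.
move=> cf.
exact: (measurable_fun_for_continuous measurable_square_open (A := setT) (fun x _ => cf x)).
Qed.

Lemma integrable_square (f : R * R -> R) M : continuous f ->
  (forall y, ~ (`|y.1| <= M /\ `|y.2| <= M) -> f y = 0) ->
  mu2.-integrable setT (fun y => (f y)%:E).
Proof.
move=> cf f0.
have mid := measurable_square_open.
apply: (integrable_compact_support (phi := fun y : m1 * m1 => y : R * R)
  (K := `[- M, M] `*` `[- M, M]) (f := f)) => //.
- by apply: compact_setX; exact: segment_compact.
- apply: compact_closed; first exact: norm_hausdorff.
  by apply: compact_setX; exact: segment_compact.
- rewrite preimage_id.
  have mI : measurable (`[- M, M]%classic : set m1) by exact: measurable_itv.
  rewrite [X in (X < _)%E](lebesgue2X mI mI).
  rewrite !lebesgue_measure_itv/=.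
  by case: ifPn => _; rewrite ?mule0 ?mul0e ?ltry// -!EFinD -!EFinM ltry.
- by move=> y ny; apply: f0; rewrite !ler_norml => -[? ?]; apply: ny; split; rewrite /= in_itv.
Qed.

Local Open Scope ereal_scope.
Implicit Types F dF : 'rV[R]_3 -> R.

Let slab b : set (borel3 R) := [set p | half_line b p.2].

Lemma measurable_slab b : measurable (slab b).
Proof.
rewrite (_ : slab b = setT `*` half_line b).
  by apply: measurableX => //; exact: measurable_half_line.
by apply/seteqP; split=> p //= [].
Qed.

Section terms.
Variables (F dF : 'rV[R]_3 -> R) (M : R) (b : bool).
Hypotheses (cF : continuous F) (cdF : continuous dF).
Hypotheses (F0 : forall x, ~ box M x -> F x = 0%R)
  (dF0 : forall x, ~ box M x -> dF x = 0%R).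

Let point3_cont (T : topologicalType) (a1 a2 a3 : T -> R) :
  continuous a1 -> continuous a2 -> continuous a3 ->
  continuous (fun t => point3 ((a1 t, a2 t), a3 t)).
Proof.
move=> c1 c2 c3 t; apply/cvg_ballP => e e0.
have /cvg_ballP/(_ e e0) h1 := c1 t.
have /cvg_ballP/(_ e e0) h2 := c2 t.
have /cvg_ballP/(_ e e0) h3 := c3 t.
near=> s.
apply/ball_rV3 => //; apply: ord3P; rewrite !point3E.
- by near: s.
- by near: s.
- by near: s.
Unshelve. all: by end_near. Qed.

Let dF_cont (T : topologicalType) (a1 a2 a3 : T -> R) :
  continuous a1 -> continuous a2 -> continuous a3 ->
  continuous (fun t => dF (point3 ((a1 t, a2 t), a3 t))).
Proof.
move=> h1 h2 h3 t.
by apply: (@continuous_comp _ _ _ (fun t => point3 ((a1 t, a2 t), a3 t)) dF);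
  [exact: point3_cont|exact: cdF].
Qed.

Let integrable_slab : mu3.-integrable setT
  ((fun p => (dF (point3 p))%:E) \_ (slab b)).
Proof.
apply/(integrable_mkcond _ (measurable_slab b)).
by apply: integrableS (integrable_box cdF dF0) => //; exact: measurable_slab.
Qed.

Let id_continuous : continuous (id : R -> R).
Proof. by move=> x; exact: cvg_id. Qed.

(** Integrating first along the lines that cross the boundary plane leaves the
    value of F at the plane. *)
Lemma slab_transverse :
  (forall a1 a2 c, is_derive c (1 : R)%R (fun z => F (point3 ((a1, a2), z)))
     (dF (point3 ((a1, a2), c)))) ->
  \int[mu3]_(p in slab b) (dF (point3 p))%:E =
  \int[mu2]_y ((-1) ^+ b * F (point3 (y, 0%R)))%:E.
Proof.
move=> dFE; rewrite integral_mkcond (fubini3_12 integrable_slab).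
apply: eq_integral => -[a1 a2] _.
rewrite -(@FTC_half_line _ (fun z => F (point3 ((a1, a2), z)))
   (fun z => dF (point3 ((a1, a2), z))) M)//.
- rewrite [RHS]integral_mkcond; apply: eq_integral => z _.
  by rewrite !patchE; congr (if _ then _ else _).
- apply: (@dF_cont R (cst a1) (cst a2) id) => //; (exact: cst_continuous || exact: id_continuous).
- by move=> z zM; apply: F0 => /(_ 2%R); rewrite point3E leNgt zM.
Qed.

(** Integrating first along lines parallel to the boundary plane: the integral
    of the derivative of a compactly supported function vanishes. *)
Lemma slab_tangent1 :
  (forall a1 a2 c, is_derive a1 (1 : R)%R (fun z => F (point3 ((z, a2), c)))
     (dF (point3 ((a1, a2), c)))) ->
  \int[mu3]_(p in slab b) (dF (point3 p))%:E = 0.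
Proof.
move=> dFE; rewrite integral_mkcond (fubini3_21 integrable_slab).
apply: integral0_eq => c _.
have [bc|bc] := pselect (half_line b c); last first.
  apply: integral0_eq => y _; rewrite patchE ifF//.
  by apply/negbTE/negP; rewrite inE.
transitivity (\int[mu2]_y (dF (point3 (y, c)))%:E).
  by apply: eq_integral => y _; rewrite patchE ifT// inE.
rewrite fubini2_21; last first.
  apply: (integrable_square (f := fun y => dF (point3 ((y.1, y.2), c))) (M := M)).
    apply: (@dF_cont (R * R)%type fst snd (cst c)); last exact: cst_continuous.
      by move=> y; exact: cvg_fst.
    by move=> y; exact: cvg_snd.
  move=> y ny; apply: dF0 => h; apply: ny.
  by have := (h 0%R, h 1%R); rewrite !point3E => -[].
apply: integral0_eq => a2 _.
apply: (@FTC_compact_support _ (fun z => F (point3 ((z, a2), c))) _ M) => //.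
- apply: (@dF_cont R id (cst a2) (cst c)) => //; (exact: cst_continuous || exact: id_continuous).
- by move=> z zM; apply: F0 => /(_ 0%R); rewrite point3E leNgt zM.
Qed.

Lemma slab_tangent2 :
  (forall a1 a2 c, is_derive a2 (1 : R)%R (fun z => F (point3 ((a1, z), c)))
     (dF (point3 ((a1, a2), c)))) ->
  \int[mu3]_(p in slab b) (dF (point3 p))%:E = 0.
Proof.
move=> dFE; rewrite integral_mkcond (fubini3_21 integrable_slab).
apply: integral0_eq => c _.
have [bc|bc] := pselect (half_line b c); last first.
  apply: integral0_eq => y _; rewrite patchE ifF//.
  by apply/negbTE/negP; rewrite inE.
transitivity (\int[mu2]_y (dF (point3 (y, c)))%:E).
  by apply: eq_integral => y _; rewrite patchE ifT// inE.
rewrite fubini2_12; last first.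
  apply: (integrable_square (f := fun y => dF (point3 ((y.1, y.2), c))) (M := M)).
    apply: (@dF_cont (R * R)%type fst snd (cst c)); last exact: cst_continuous.
      by move=> y; exact: cvg_fst.
    by move=> y; exact: cvg_snd.
  move=> y ny; apply: dF0 => h; apply: ny.
  by have := (h 0%R, h 1%R); rewrite !point3E => -[].
apply: integral0_eq => a1 _.
apply: (@FTC_compact_support _ (fun z => F (point3 ((a1, z), c))) _ M) => //.
- apply: (@dF_cont R (cst a1) id (cst c)) => //; (exact: cst_continuous || exact: id_continuous).
- by move=> z zM; apply: F0 => /(_ 1%R); rewrite point3E leNgt zM.
Qed.

End terms.
End flat_divergence.

(** * The divergence theorem on one side of a graph *)

Definition divergence {R : realType} (F : 'rV[R]_3 -> 'rV[R]_3) (x : 'rV[R]_3) : R :=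
  \sum_i partial i (fun y => F y 0 i) x.

Lemma ord3_rot (k : 'I_3) : ((k + 1 == k) = false) * ((k + 2 == k) = false) *
  ((k + 2 == k + 1) = false) * ((k == k + 1) = false) * ((k == k + 2) = false) *
  ((k + 1 == k + 2) = false).
Proof. by move: k; apply: ord3P; do ! split. Qed.

Lemma ord3_cases (k : 'I_3) (P : 'I_3 -> Prop) :
  P k -> P (k + 1) -> P (k + 2) -> forall i, P i.
Proof.
have e (a b : 'I_3) : val a = val b -> P a -> P b by move=> /val_inj ->.
move: k; apply: ord3P => P0 P1 P2; apply: ord3P;
  by [exact: P0|exact: P1|exact: P2|exact: (e _ _ _ P0)|exact: (e _ _ _ P1)|exact: (e _ _ _ P2)].
Qed.

Lemma sum3_rot (V : zmodType) (k : 'I_3) (f : 'I_3 -> V) :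
  \sum_i f i = f k + f (k + 1) + f (k + 2).
Proof.
rewrite (bigD1 k)//= (bigD1 (k + 1))/=; last by rewrite ord3_rot.
rewrite (bigD1 (k + 2))/=; last by rewrite !ord3_rot.
rewrite big1 ?addr0; first by rewrite -[RHS]addrA.
move=> i.
move: i; apply: (ord3_cases (k := k)); by rewrite ?eqxx ?ord3_rot ?eqxx ?andbF.
Qed.

Section graph_point.
Context {R : realType}.
Implicit Types (k : 'I_3) (g : R * R -> R).

Lemma graph_point_coord k g (y : R * R) :
  (graph_point k g y 0 k = g y) * (graph_point k g y 0 (k + 1) = y.1) *
   (graph_point k g y 0 (k + 2) = y.2).
Proof. by rewrite /graph_point !mxE !eqxx !ord3_rot. Qed.

Lemma graph_pointE k g (y : R * R) :
  graph_point k g y = g y *: basis k + y.1 *: basis (k + 1) + y.2 *: basis (k + 2).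
Proof.
apply/rowP; apply: (ord3_cases (k := k)); rewrite graph_point_coord !mxE !eqxx !ord3_rot;
  by rewrite ?mulr1 ?mulr0 ?addr0 ?add0r.
Qed.

Lemma continuous_forP (T T' : topologicalType) (f : T -> T') :
  (forall x, {for x, continuous f}) -> continuous f.
Proof. by []. Qed.

Lemma rV3_continuous (T : topologicalType) (f : T -> 'rV[R]_3) :
  (forall i, continuous (fun t => f t 0 i)) -> continuous f.
Proof.
move=> cf t; apply/cvg_ballP => e e0.
have /cvg_ballP/(_ e e0) h0 := cf 0 t.
have /cvg_ballP/(_ e e0) h1 := cf 1 t.
have /cvg_ballP/(_ e e0) h2 := cf 2 t.
near=> s.
by apply/ball_rV3 => //; apply: ord3P; near: s.
Unshelve. all: by end_near. Qed.

Lemma graph_point_continuous (T : topologicalType) k (h y1 y2 : T -> R) :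
  continuous h -> continuous y1 -> continuous y2 ->
  continuous (fun t => graph_point k (fun=> h t) (y1 t, y2 t)).
Proof.
move=> ch c1 c2; apply: rV3_continuous => i.
rewrite (_ : (fun _ => _) = fun t => if i == k then h t
    else if i == k + 1 then y1 t else y2 t); last first.
  by apply/funext => t; rewrite /graph_point mxE.
by case: (i == k) => //; case: (i == k + 1).
Qed.

Lemma pair_continuous (T U V : topologicalType) (f : T -> U) (h : T -> V) :
  continuous f -> continuous h -> continuous (fun t => (f t, h t)).
Proof. by move=> cf ch t; apply: cvg_pair; [exact: cf|exact: ch]. Qed.

Lemma differentiable_id (V : normedModType R) (x : V) : differentiable id x.
Proof. by []. Qed.

Lemma derive_scalel (V W : normedModType R) (f : V -> R) (w : W) x v :
  differentiable f x -> 'D_v (fun y => f y *: w) x = 'D_v f x *: w.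
Proof.
move=> df; rewrite deriveE; last exact: differentiableZl.
by rewrite diffZl// deriveE.
Qed.

Lemma derive_id_scale (W : normedModType R) (w : W) (t : R) :
  'D_1 (fun z : R => z *: w) t = w.
Proof. by rewrite (derive_scalel _ _ (differentiable_id t)) derive_id scale1r. Qed.

Lemma derive_shift (f : R -> R) (s t : R) : differentiable f t ->
  'D_1 (fun z => f z + s) t = 'D_1 f t.
Proof.
by move=> df; rewrite (@deriveD _ _ _ f (cst s)) ?derive_cst ?addr0//; exact: diff_derivable.
Qed.

Lemma is_derive_curve (h : 'rV[R]_3 -> R) (c : R -> 'rV[R]_3) (t : R) w :
  differentiable h (c t) -> differentiable c t -> 'D_1 c t = w ->
  is_derive t (1 : R) (fun z => h (c z)) ('D_w h (c t)).
Proof.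
move=> dh dc <-; apply: DeriveDef.
  by apply: diff_derivable; exact: (@differentiable_comp _ _ _ _ c h).
exact: (@derive_comp _ _ _ _ c h).
Qed.

(** The images under the shear of the three coordinate lines are
    differentiable curves; their velocities are the columns of its Jacobian
    matrix. *)
Lemma curve_height k g (y : R * R) (z : R) (c := fun z => graph_point k (fun y => g y + z) y) :
  differentiable c z /\ 'D_1 c z = basis k.
Proof.
rewrite /c (_ : (fun z => _) = (fun z => (g y + z) *: basis k) +
   cst (y.1 *: basis (k + 1) + y.2 *: basis (k + 2))); last first.
  by apply/funext => ?; rewrite graph_pointE/= fctE -addrA.
have d : differentiable (fun z => g y + z) z.
  by apply: differentiableD => //; exact: differentiable_cst.
have dz : differentiable (fun z => (g y + z) *: basis k : 'rV[R]_3) z.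
  exact: differentiableZl.
split; first by apply: differentiableD => //; exact: differentiable_cst.
rewrite deriveD; [|exact: diff_derivable..].
rewrite derive_cst addr0 derive_scalel//.
rewrite (@deriveD _ _ _ (cst (g y)) id)//.
by rewrite derive_cst add0r derive_id scale1r.
Qed.

Lemma curve_abscissa k g (a b s : R) (y := (a, b) : R * R)
   (c := fun z => graph_point k (fun y => g y + s) (z, b)) :
  differentiable g y -> differentiable c a /\ 'D_1 c a = 'D_(1, 0) g y *: basis k + basis (k + 1).
Proof.
move=> dg.
have dp : differentiable (fun z : R => (z, b)) a.
  by apply: differentiable_pair => //; exact: differentiable_cst.
have dg1 : differentiable (fun z => g (z, b)) a.
  exact: (@differentiable_comp _ _ _ _ (fun z => (z, b)) g).
have d1 : differentiable (fun z => g (z, b) + s) a.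
  by apply: differentiableD => //; exact: differentiable_cst.
have d2 : differentiable (fun z => (g (z, b) + s) *: basis k : 'rV[R]_3) a.
  exact: differentiableZl.
have d3 : differentiable (fun z : R => z *: basis (k + 1) : 'rV[R]_3) a.
  exact: differentiableZl.
rewrite /c (_ : (fun z => _) = (fun z => (g (z, b) + s) *: basis k) +
   (fun z => z *: basis (k + 1)) + cst (b *: basis (k + 2))); last first.
  by apply/funext => ?; rewrite graph_pointE/= !fctE.
split.
  apply: differentiableD; last exact: differentiable_cst.
  exact: differentiableD.
rewrite deriveD; [|apply: diff_derivable; exact: differentiableD|exact: derivable_cst].
rewrite derive_cst addr0 deriveD; [|exact: diff_derivable..].
congr (_ + _).
  rewrite (derive_scalel _ _ d1); congr (_ *: _).
  have e1 := derive_slice (F := g) (1 : R) dg.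
  have e2 := derive_shift s dg1.
  exact: etrans e2 e1.
exact: (derive_id_scale (basis (k + 1)) a).
Qed.

Lemma curve_ordinate k g (a b s : R) (y := (a, b) : R * R)
   (c := fun z => graph_point k (fun y => g y + s) (a, z)) :
  differentiable g y -> differentiable c b /\ 'D_1 c b = 'D_(0, 1) g y *: basis k + basis (k + 2).
Proof.
move=> dg.
have dp : differentiable (fun z : R => (a, z)) b.
  by apply: differentiable_pair => //; exact: differentiable_cst.
have dg1 : differentiable (fun z => g (a, z)) b.
  exact: (@differentiable_comp _ _ _ _ (fun z => (a, z)) g).
have d1 : differentiable (fun z => g (a, z) + s) b.
  by apply: differentiableD => //; exact: differentiable_cst.
have d2 : differentiable (fun z => (g (a, z) + s) *: basis k : 'rV[R]_3) b.
  exact: differentiableZl.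
have d3 : differentiable (fun z : R => z *: basis (k + 2) : 'rV[R]_3) b.
  exact: differentiableZl.
rewrite /c (_ : (fun z => _) = (fun z => (g (a, z) + s) *: basis k) +
   cst (a *: basis (k + 1)) + (fun z => z *: basis (k + 2))); last first.
  by apply/funext => ?; rewrite graph_pointE/= !fctE.
have d4 : differentiable ((fun z => (g (a, z) + s) *: basis k : 'rV[R]_3) +
    cst (a *: basis (k + 1))) b.
  by apply: differentiableD => //; exact: differentiable_cst.
split; first exact: differentiableD.
rewrite deriveD; [|exact: diff_derivable..].
rewrite deriveD; [|exact: diff_derivable|exact: derivable_cst].
rewrite derive_cst addr0; congr (_ + _).
  rewrite (derive_scalel _ _ d1); congr (_ *: _).
  have [_ e1] := derive1_slice dg.
  have e2 := derive_shift s dg1.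
  exact: (etrans e2 (etrans (esym (derive1E _ _)) e1)).
exact: (derive_id_scale (basis (k + 2)) b).
Qed.

End graph_point.

Section local_divergence.
Context {R : realType}.
Local Notation mu1 := (@lebesgue_measure R).
Local Notation mu2 := (@lebesgue2 R).
Local Notation mu3 := (@lebesgue3 R).
Variables (k : 'I_3) (b : bool) (g : R * R -> R) (G : 'rV[R]_3 -> 'rV[R]_3) (M : R).
Hypotheses (c1g : forall y, c1 g y) (c1G : forall x j, c1 (fun x => G x 0 j) x).
Hypothesis G0 : forall x, ~ box M x -> G x = 0.

Definition side : set 'rV[R]_3 :=
  [set x | 0 < (-1) ^+ b * (g (x 0 (k + 1), x 0 (k + 2)) - x 0 k)].

(** The scalar product of G with the non-normalised normal
    (1, - dg/dy_1, - dg/dy_2) in the axes k, k+1, k+2: the unit normal times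
    the area density. *)
Definition flux (y : R * R) (x : 'rV[R]_3) : R :=
  G x 0 k - 'D_(1, 0) g y * G x 0 (k + 1) - 'D_(0, 1) g y * G x 0 (k + 2).

Let D i j := 'D_(basis i) (fun x => G x 0 j).
Let g1 := 'D_(1, 0) g.
Let g2 := 'D_(0, 1) g.
Let pr (x : 'rV[R]_3) : R * R := (x 0 0, x 0 1).
(** The shear in row vectors, and the fields in sheared coordinates. *)
Let S (x : 'rV[R]_3) := graph_point k (fun y => g y + x 0 2) (pr x).
Let P (x : 'rV[R]_3) : R := flux (pr x) (S x).
Let dP (x : 'rV[R]_3) : R := D k k (S x) - g1 (pr x) * D k (k + 1) (S x) - g2 (pr x) * D k (k + 2) (S x).
Let Q1 (x : 'rV[R]_3) : R := G (S x) 0 (k + 1).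
Let dQ1 (x : 'rV[R]_3) : R := g1 (pr x) * D k (k + 1) (S x) + D (k + 1) (k + 1) (S x).
Let Q2 (x : 'rV[R]_3) : R := G (S x) 0 (k + 2).
Let dQ2 (x : 'rV[R]_3) : R := g2 (pr x) * D k (k + 2) (S x) + D (k + 2) (k + 2) (S x).

Let shearE p : shear k g p = S (point3 p).
Proof. by rewrite /S /pr !point3E /shear -surjective_pairing. Qed.

Let divS x : divergence G (S x) = dP x + dQ1 x + dQ2 x.
Proof.
rewrite /divergence (sum3_rot k) /partial -/(D k k (S x)).
rewrite -/(D (k + 1) (k + 1) (S x)) -/(D (k + 2) (k + 2) (S x)).
rewrite /dP /dQ1 /dQ2.
move: (D k k _) (D (k + 1) _ _) (D (k + 2) _ _) (g1 _ * _) (g2 _ * _) => *; ring.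
Qed.

Let cpr : continuous pr.
Proof. by apply: pair_continuous; exact: coord_continuous. Qed.

Let cg : continuous g.
Proof. by move=> y; exact: c1_continuous (c1g y). Qed.

Let cg1 : continuous g1. Proof. by move=> y; exact: (c1g y).2. Qed.
Let cg2 : continuous g2. Proof. by move=> y; exact: (c1g y).2. Qed.

Let cS : continuous S.
Proof.
apply: (@graph_point_continuous _ _ k (fun x => g (pr x) + x 0 2)
  (fun x => x 0 0) (fun x => x 0 1)); try exact: coord_continuous.
move=> x; apply: for_continuousD; last exact: coord_continuous.
exact: (for_continuous_comp (@cpr x) (@cg _)).
Qed.

Let cGS j : continuous (fun x => G (S x) 0 j).
Proof.
move=> x; apply: (for_continuous_comp (h := fun x => G x 0 j) (@cS x)).
exact: c1_continuous.
Qed.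

Let cDS i j : continuous (fun x => D i j (S x)).
Proof. by move=> x; exact: (for_continuous_comp (@cS x) ((c1G _ j).2 _)). Qed.

Let cg1p : continuous (fun x => g1 (pr x)).
Proof. by move=> x; exact: (for_continuous_comp (@cpr x) (@cg1 _)). Qed.

Let cg2p : continuous (fun x => g2 (pr x)).
Proof. by move=> x; exact: (for_continuous_comp (@cpr x) (@cg2 _)). Qed.

Let cP : continuous P.
Proof.
apply: continuous_forP => x; rewrite /P /flux; apply: for_continuousD; first apply: for_continuousD.
- exact: cGS.
- by apply: for_continuousN; apply: for_continuousM; [exact: cg1p|exact: cGS].
- by apply: for_continuousN; apply: for_continuousM; [exact: cg2p|exact: cGS].
Qed.

Let cdP : continuous dP.
Proof.
apply: continuous_forP => x; rewrite /dP; apply: for_continuousD; first apply: for_continuousD.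
- exact: cDS.
- by apply: for_continuousN; apply: for_continuousM; [exact: cg1p|exact: cDS].
- by apply: for_continuousN; apply: for_continuousM; [exact: cg2p|exact: cDS].
Qed.

Let cdQ1 : continuous dQ1.
Proof.
apply: continuous_forP => x; rewrite /dQ1; apply: for_continuousD; last exact: cDS.
by apply: for_continuousM; [exact: cg1p|exact: cDS].
Qed.

Let cdQ2 : continuous dQ2.
Proof.
apply: continuous_forP => x; rewrite /dQ2; apply: for_continuousD; last exact: cDS.
by apply: for_continuousM; [exact: cg2p|exact: cDS].
Qed.

Let D0 i j x : ~ box M x -> D i j x = 0.
Proof.
move=> nx; rewrite /D (@near_eq_derive _ _ _ _ (cst 0)) ?derive_cst//.
have o : nbhs x (~` box M) by apply: open_nbhs_nbhs; split => //; exact/closed_openC/closed_box.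
by apply: filterS o => z nz; rewrite G0// mxE.
Qed.

(** Only points of a bounded set are sheared into the box, since g is bounded
    on squares. *)
Let support : exists N, forall x, ~ box N x -> ~ box M (S x).
Proof.
have [C hC] : exists C, forall y, `|y.1| <= M -> `|y.2| <= M -> `|g y| <= C.
  have cc : compact (g @` (`[- M, M] `*` `[- M, M])).
    apply: continuous_compact; first exact: continuous_subspaceT.
    by apply: compact_setX; exact: segment_compact.
  have [C [_ hC]] := compact_bounded cc.
  exists (C + 1) => y y1 y2; apply: hC; first by rewrite ltrDl.
  by exists y => //; split; rewrite /= in_itv/= -ler_norml.
exists (M + `|C|) => x nx Sx; apply: nx.
have h1 : `|x 0 0| <= M by have := Sx (k + 1); rewrite /S graph_point_coord.
have h2 : `|x 0 1| <= M by have := Sx (k + 2); rewrite /S graph_point_coord.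
have h3 : `|g (pr x) + x 0 2| <= M by have := Sx k; rewrite /S graph_point_coord.
apply: ord3P.
- by rewrite (le_trans h1)// lerDl.
- by rewrite (le_trans h2)// lerDl.
- rewrite (_ : x 0 2 = (g (pr x) + x 0 2) - g (pr x)); last by ring.
  rewrite (le_trans (ler_normB _ _))// lerD// (le_trans (hC (pr x) h1 h2))//.
  exact: ler_norm.
Qed.

Let dGc j x : differentiable (fun x => G x 0 j) x.
Proof. exact: c1_differentiable. Qed.

Let P_derive a1 a2 (c : R) : is_derive c (1 : R) (fun z => P (point3 ((a1, a2), z)))
     (dP (point3 ((a1, a2), c))).
Proof.
pose cu z := graph_point k (fun y => g y + z) (a1, a2).
have SE z : S (point3 ((a1, a2), z)) = cu z by rewrite /S /pr !point3E.
have prE z : pr (point3 ((a1, a2), z)) = (a1, a2) by rewrite /pr !point3E.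
have [dc Dc] := curve_height k g (a1, a2) c.
have d j : is_derive c (1 : R) (fun z => G (cu z) 0 j) (D k j (cu c)).
  exact: (is_derive_curve (h := fun x => G x 0 j) (dGc j _) dc Dc).
rewrite /dP SE prE (_ : (fun z => P _) = (fun z => G (cu z) 0 k) -
  g1 (a1, a2) \*: (fun z => G (cu z) 0 (k + 1)) - g2 (a1, a2) \*: (fun z => G (cu z) 0 (k + 2))).
  by apply: is_deriveB.
by apply/funext => z; rewrite /P SE prE /flux.
Qed.

Let Q1_derive (a1 : R) a2 c : is_derive a1 (1 : R) (fun z => Q1 (point3 ((z, a2), c)))
     (dQ1 (point3 ((a1, a2), c))).
Proof.
pose cu z := graph_point k (fun y => g y + c) (z, a2).
have SE z : S (point3 ((z, a2), c)) = cu z by rewrite /S /pr !point3E.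
have prE z : pr (point3 ((z, a2), c)) = (z, a2) by rewrite /pr !point3E.
have [dc Dc] := curve_abscissa k c (c1_differentiable (c1g (a1, a2))).
have := is_derive_curve (h := fun x => G x 0 (k + 1)) (dGc _ _) dc Dc.
rewrite derive_lincomb; last exact: dGc.
rewrite /dQ1 SE prE (_ : (fun z => Q1 _) = (fun z => G (cu z) 0 (k + 1))) //.
by apply/funext => z; rewrite /Q1 SE.
Qed.

Let Q2_derive a1 (a2 : R) c : is_derive a2 (1 : R) (fun z => Q2 (point3 ((a1, z), c)))
     (dQ2 (point3 ((a1, a2), c))).
Proof.
pose cu z := graph_point k (fun y => g y + c) (a1, z).
have SE z : S (point3 ((a1, z), c)) = cu z by rewrite /S /pr !point3E.
have prE z : pr (point3 ((a1, z), c)) = (a1, z) by rewrite /pr !point3E.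
have [dc Dc] := curve_ordinate k c (c1_differentiable (c1g (a1, a2))).
have := is_derive_curve (h := fun x => G x 0 (k + 2)) (dGc _ _) dc Dc.
rewrite derive_lincomb; last exact: dGc.
rewrite /dQ2 SE prE (_ : (fun z => Q2 _) = (fun z => G (cu z) 0 (k + 2))) //.
by apply/funext => z; rewrite /Q2 SE.
Qed.

Let cdiv : continuous (divergence G).
Proof.
apply: continuous_forP => x; rewrite (_ : divergence G = fun x =>
    D 0 0 x + D (0 + 1) (0 + 1) x + D (0 + 2) (0 + 2) x); last first.
  by apply/funext => z; rewrite /divergence (sum3_rot 0).
by apply: for_continuousD; [apply: for_continuousD|]; exact: (c1G _ _).2.
Qed.

Lemma open_side : open side.
Proof.
pose h (x : 'rV[R]_3) := (-1) ^+ b * (g (x 0 (k + 1), x 0 (k + 2)) - x 0 k).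
have ch : continuous h.
  apply: continuous_forP => x; rewrite /h.
  apply: for_continuousM; first exact: cst_continuous.
  apply: for_continuousD; last by apply: for_continuousN; exact: coord_continuous.
  apply: (for_continuous_comp (f := fun x : 'rV[R]_3 => (x 0 (k + 1), x 0 (k + 2)))); last exact: cg.
  by apply: pair_continuous; exact: coord_continuous.
rewrite (_ : side = h @^-1` [set z | 0 < z]); last by [].
by apply: open_comp => //; move=> x _; exact: ch.
Qed.

Let f x : R := if x \in side then divergence G x else 0.

Let mside : measurable (@point3 R @^-1` side).
Proof. apply: measurable_point3; exact: open_side. Qed.

Let mdiv : measurable_fun setT (divergence G \o @point3 R).
Proof.
have := measurable_fun_for_continuous (@measurable_point3 R) (A := setT) (fun x _ => @cdiv x).
by rewrite preimage_setT.
Qed.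

Let mf : measurable_fun setT (f \o @point3 R).
Proof.
rewrite (_ : f \o _ = (divergence G \o @point3 R) \_ (@point3 R @^-1` side)); last first.
  by apply/funext => p; rewrite patchE /f /=.
apply/(measurable_restrict _ mside) => //.
exact: measurable_funS mdiv.
Qed.

Let f_shear p : f (shear k g p) =
  if p \in [set p | half_line b p.2] then dP (point3 p) + dQ1 (point3 p) + dQ2 (point3 p) else 0.
Proof.
rewrite /f -divS -shearE; congr (if _ then _ else _).
have e : side (shear k g p) = half_line b p.2.
  rewrite /side /half_line /= /shear !graph_point_coord -surjective_pairing.
  by congr (is_true (0 < _ * _)); ring.
by apply/idP/idP; rewrite !inE ?e// => ?; rewrite /mkset -?e // e.
Qed.

(** In sheared coordinates the divergence is P_z + (Q1)_1 + (Q2)_2, where P is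
    the flux through the translated graph and Q1, Q2 are the tangential
    components of G: the terms in dg/dy_1 and dg/dy_2 of the Jacobian cancel.
    On the straightened half-space the tangential terms integrate to zero and
    the transverse one leaves the flux through the graph. *)
Lemma local_divergence_theorem :
  [/\ mu3.-integrable (@point3 R @^-1` side) (fun p => (divergence G (point3 p))%:E),
      mu2.-integrable setT (fun y => ((-1) ^+ b * flux y (graph_point k g y))%:E) &
      (\int[mu3]_(p in @point3 R @^-1` side) (divergence G (point3 p))%:E =
       \int[mu2]_y ((-1) ^+ b * flux y (graph_point k g y))%:E)%E ].
Proof.
have [N SN] := support.
have P0 x : ~ box N x -> P x = 0.
  by move=> /SN /G0 GS0; rewrite /P /flux GS0 !mxE !mulr0 !subr0.
have dP0 x : ~ box N x -> dP x = 0.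
  by move=> /SN h; rewrite /dP !D0// !mulr0 !subr0.
have Q10 x : ~ box N x -> Q1 x = 0 by move=> /SN /G0 GS0; rewrite /Q1 GS0 mxE.
have Q20 x : ~ box N x -> Q2 x = 0 by move=> /SN /G0 GS0; rewrite /Q2 GS0 mxE.
have dQ10 x : ~ box N x -> dQ1 x = 0.
  by move=> /SN h; rewrite /dQ1 !D0// !mulr0 !addr0.
have dQ20 x : ~ box N x -> dQ2 x = 0.
  by move=> /SN h; rewrite /dQ2 !D0// !mulr0 !addr0.
pose slab : set (borel3 R) := [set p | half_line b p.2].
have mslab : measurable slab := measurable_slab b.
have iP : mu3.-integrable slab (fun p => (dP (point3 p))%:E).
  by apply: integrableS (integrable_box cdP dP0) => //.
have iQ1 : mu3.-integrable slab (fun p => (dQ1 (point3 p))%:E).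
  by apply: integrableS (integrable_box cdQ1 dQ10) => //.
have iQ2 : mu3.-integrable slab (fun p => (dQ2 (point3 p))%:E).
  by apply: integrableS (integrable_box cdQ2 dQ20) => //.
have iPQ1 : mu3.-integrable slab (fun p => (dP (point3 p))%:E + (dQ1 (point3 p))%:E)%E.
  exact: integrableD.
have iPQ : mu3.-integrable slab (fun p => (dP (point3 p))%:E + (dQ1 (point3 p))%:E +
    (dQ2 (point3 p))%:E)%E by exact: integrableD.
have fE : (fun p => (f (shear k g p))%:E) =
    (fun p => (dP (point3 p))%:E + (dQ1 (point3 p))%:E + (dQ2 (point3 p))%:E)%E \_ slab.
  by apply/funext => p; rewrite f_shear patchE; case: ifPn.
have f3E : (fun p => (divergence G (point3 p))%:E) \_ (@point3 R @^-1` side) =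
    (fun p => (f (point3 p))%:E).
  apply/funext => p; rewrite patchE /f.
  have -> : (p \in @point3 R @^-1` side) = (point3 p \in side) by apply/idP/idP; rewrite !inE.
  by case: ifP.
have mg : measurable_fun [set: measurableTypeR R * measurableTypeR R] g.
  exact: measurable_square.
split.
- apply/(integrable_mkcond _ mside); rewrite f3E.
  apply: (integrable_shear (k := k) mg mf); rewrite fE.
  exact/(integrable_mkcond _ mslab).
- pose h y := (-1) ^+ b * P (point3 (y, 0)).
  have hE : (fun y => (h y)%:E) = (fun y => ((-1) ^+ b * flux y (graph_point k g y))%:E).
    apply/funext => -[y1 y2]; rewrite /h /P /S /pr !point3E /=.
    congr (_ * flux _ _)%:E; apply/rowP => i; rewrite /graph_point !mxE.
    by case: ifP => //; rewrite addr0.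
  rewrite -hE; apply: (integrable_square (M := N)).
    apply: continuous_forP => y; rewrite /h; apply: for_continuousM; first exact: cst_continuous.
    apply: (for_continuous_comp (f := fun y : R * R => point3 (y, 0))); last exact: cP.
    apply: rV3_continuous; apply: ord3P.
    + by rewrite (_ : (fun _ => _) = fst) => [z|]; [exact: cvg_fst|apply/funext => z; rewrite point3E].
    + by rewrite (_ : (fun _ => _) = snd) => [z|]; [exact: cvg_snd|apply/funext => z; rewrite point3E].
    + by rewrite (_ : (fun _ => _) = cst 0) => [|]; [exact: cst_continuous|apply/funext => z; rewrite point3E].
  move=> y ny; rewrite /h P0 ?mulr0// => hb; apply: ny.
  by have := (hb 0, hb 1); rewrite !point3E => -[].
- rewrite integral_mkcond f3E (integral_shear k mg mf) fE -integral_mkcond.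
  rewrite (integralD mslab iPQ1 iQ2) (integralD mslab iP iQ1).
  rewrite (slab_transverse b cdP P0 dP0 P_derive).
  rewrite (slab_tangent1 b cdQ1 Q10 dQ10 Q1_derive).
  rewrite (slab_tangent2 b cdQ2 Q20 dQ20 Q2_derive) !adde0.
  apply: eq_integral => -[y1 y2] _; rewrite /P /S /pr !point3E /=.
  congr (_ * flux _ _)%:E; apply/rowP => i; rewrite /graph_point !mxE.
  by case: ifP => //; rewrite addr0.
Qed.

End local_divergence.

(** * Bump functions *)

Lemma in_preimageE (T U : Type) (f : T -> U) (A : set U) (p : T) :
  (p \in f @^-1` A) = (f p \in A).
Proof. by apply/idP/idP; rewrite !inE. Qed.

Lemma for_continuous_sqr (R : realType) (T : topologicalType) (f : T -> R) x :
  {for x, continuous f} -> {for x, continuous (fun y => f y ^+ 2)}.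
Proof.
move=> cf; rewrite (_ : (fun y => f y ^+ 2) = fun y => f y * f y); last first.
  by apply/funext => y; rewrite expr2.
exact: for_continuousM.
Qed.

Lemma max_subN (R : realDomainType) (w : R) : Num.max w 0 - Num.max (- w) 0 = w.
Proof.
have [w0|/ltW w0] := lerP 0 w.
  by rewrite max_r ?oppr_le0// subr0.
by rewrite max_l ?oppr_ge0// sub0r opprK.
Qed.

Section bump.
Context {R : realType}.

(** A C^1 function vanishing exactly for u <= 0; one derivative is all that
    the bump functions need. *)
Definition sqr_pos (u : R) : R := (Num.max 0 u) ^+ 2.

Lemma sqr_pos_derive (u : R) : is_derive u (1 : R) sqr_pos (2 * Num.max 0 u).
Proof.
have [u0|u0|->] := ltgtP u 0.
- rewrite mulr0.
  apply: (near_eq_is_derive _ (is_derive_cst (0 : R) u (1 : R))).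
  have : \forall y \near u, y < 0 by exact: lt_nbhsl.
  by apply: filterS => y y0; rewrite /sqr_pos (max_l (ltW y0)) expr0n.
- have dX : is_derive u (1 : R) (id ^+ 2) (2 * u).
    have := @is_deriveX R R id 2 u 1 1 (is_derive_id _ _).
    by rewrite /= expr1 /GRing.scale/= mulr1.
  apply: (near_eq_is_derive _ dX).
  have : \forall y \near u, 0 < y by exact: lt_nbhsr.
  by apply: filterS => y y0; rewrite /sqr_pos (max_r (ltW y0)) exprfctE.
- rewrite ?maxxx mulr0.
  have h : (fun h => h^-1 *: ((sqr_pos \o shift 0) (h *: (1 : R)) - sqr_pos 0)) @ 0^' --> (0 : R).
    apply/cvgr0Pnorm_lt => e e0; near=> h.
    rewrite /= /shift/= addr0 /sqr_pos maxxx expr0n subr0 /GRing.scale/= mulr1.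
    have [h0|h0] := leP h 0.
      by rewrite expr0n mulr0 normr0.
    rewrite expr2 mulrA mulVf ?gt_eqF// mul1r.
    by near: h; exact: dnbhs0_lt.
  apply: DeriveDef; first by apply/cvg_ex; exists 0.
  exact: cvg_lim h.
Unshelve. all: by end_near. Qed.

Lemma max0_continuous : continuous (fun u : R => Num.max 0 u).
Proof.
apply: continuous_forP => u.
by apply: (@continuous_max _ _ (cst 0) id); [exact: cst_continuous|exact: cvg_id].
Qed.

Lemma c1_sqr_pos (u : R) : c1 sqr_pos u.
Proof.
have d u' : differentiable sqr_pos u'.
  by apply/derivable1_diffP; have [] := sqr_pos_derive u'.
apply: (@c1_from R R R sqr_pos (fun v y : R => v * (2 * Num.max 0 y)) u).
- exact: (@nearW _ (nbhs u) _ _ d).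
- move=> v; apply: (@nearW _ (nbhs u)) => y.
  rewrite -[in LHS](addr0 v) -[X in 'D_(X + _) _ _ = _](mulr1 v).
  rewrite derive_lincomb// derive0 addr0.
  by rewrite (@derive_val _ _ _ _ _ _ _ (sqr_pos_derive y)).
- move=> v; apply: for_continuousM; first exact: cst_continuous.
  by apply: for_continuousM; [exact: cst_continuous|exact: max0_continuous].
Qed.

(** Equal to 0 outside the cube of half-side d around c and to 1 on the cube
    of half-side d / 4: the inner sqr_pos is a bump with values at least 1 / 2
    on the small cube, and the outer one cuts it off at that height. *)
Definition bump (c : 'rV[R]_3) (d : R) (x : 'rV[R]_3) : R :=
  1 - sqr_pos (1 - 2 * sqr_pos (1 - \sum_i ((x 0 i - c 0 i) / d) ^+ 2)).

Lemma c1_bump c d x : c1 (bump c d) x.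
Proof.
pose w (x : 'rV[R]_3) : R := ((x 0 0 - c 0 0) / d) * ((x 0 0 - c 0 0) / d)
  + ((x 0 1 - c 0 1) / d) * ((x 0 1 - c 0 1) / d)
  + ((x 0 2 - c 0 2) / d) * ((x 0 2 - c 0 2) / d).
have c1w : c1 w x.
  have h i : c1 (fun x : 'rV[R]_3 => (x 0 i - c 0 i) / d) x.
    apply: c1M; last exact: c1_cst.
    by apply: c1B; [apply: c1_coord; exact: c1_id|exact: c1_cst].
  by apply: c1D; [apply: c1D|]; apply: c1M.
have E : bump c d = fun x => 1 - sqr_pos (1 - 2 * sqr_pos (1 - w x)).
  apply/funext => z; rewrite /bump /w !big_ord_recl big_ord0 addr0 addrA !expr2.
  have -> : lift ord0 ord0 = 1 :> 'I_3 by exact: val_inj.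
  by have -> : lift ord0 (lift ord0 ord0) = 2 :> 'I_3 by exact: val_inj.
rewrite E; apply: c1B; first exact: c1_cst.
apply: (c1_comp (c1_sqr_pos _)); apply: c1B; first exact: c1_cst.
apply: c1M; first exact: c1_cst.
by apply: (c1_comp (c1_sqr_pos _)); apply: c1B; [exact: c1_cst|].
Qed.

Lemma bump_eq0 (c : 'rV[R]_3) (d : R) (x : 'rV[R]_3) :
  0 < d -> (exists i, d <= `|x 0 i - c 0 i|) -> bump c d x = 0.
Proof.
move=> d0 [i hi]; rewrite /bump; set w := \sum_j _.
have w1 : 1 <= w.
  rewrite /w (bigD1 i)//= -[1]addr0 lerD//; last by apply: sumr_ge0 => j _; exact: sqr_ge0.
  rewrite -real_normK ?num_real// normrM normfV (gtr0_norm d0) -[1](expr1n _ 2).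
  by rewrite lerXn2r ?nnegrE ?divr_ge0 ?normr_ge0 ?(ltW d0)// ler_pdivlMr// mul1r.
have -> : sqr_pos (1 - w) = 0 by rewrite /sqr_pos max_l ?expr0n// subr_le0.
by rewrite mulr0 subr0 /sqr_pos max_r// expr1n subrr.
Qed.

Lemma bump_eq1 (c : 'rV[R]_3) (d : R) (x : 'rV[R]_3) :
  0 < d -> (forall i, `|x 0 i - c 0 i| < d / 4) -> bump c d x = 1.
Proof.
move=> d0 hx; rewrite /bump; set w := \sum_j _.
have w1 : w <= 3 / 16.
  rewrite (_ : 3 / 16 = \sum_(j < 3) 1 / 16 :> R); last first.
    by rewrite sumr_const card_ord -mulr_natl; lra.
  apply: ler_sum => j _; rewrite -real_normK ?num_real//.
  rewrite normrM normfV (gtr0_norm d0) (_ : 1 / 16 = (1 / 4) ^+ 2 :> R); last by field.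
  rewrite lerXn2r ?nnegrE ?divr_ge0 ?normr_ge0 ?(ltW d0)// ler_pdivrMr//.
  by rewrite ltW//; have := hx j; lra.
(* (1 - 3 / 16)^2 = 169 / 256 > 1 / 2, which is why the factor is 1 / 4. *)
have h1 : sqr_pos (1 - w) >= 1 / 2.
  rewrite /sqr_pos max_r; last by lra.
  nra.
by rewrite {1}/sqr_pos max_l ?expr0n ?subr0//; lra.
Qed.

End bump.

(** * The divergence theorem on a bounded domain of class C^1 *)

Lemma bounded_sub_box {R : realType} (A : set 'rV[R]_3) :
  bounded_set A -> exists M, A `<=` box M.
Proof.
move=> [M [_ hM]]; exists (M + 1) => x Ax i.
have := hM (M + 1) ltac:(by rewrite ltrDl) x Ax.
apply: le_trans; rewrite [leRHS]mx_normrE.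
exact: (le_bigmax _ (fun ij => `|x ij.1 ij.2|) (0, i)).
Qed.

Lemma compact_closure {R : realType} (A : set 'rV[R]_3) : bounded_set A -> compact (closure A).
Proof.
move=> bA; have [M hM] := bounded_sub_box bA.
have sub : closure A `<=` box M.
  have e := (closure_id (box M)).1 (@closed_box R _); rewrite e.
  exact: closure_subset.
apply: (subclosed_compact _ (@compact_box R M) sub).
exact: closed_closure.
Qed.

Section surface.
Context {R : realType}.
Local Notation mu2 := (@lebesgue2 R).
Local Notation mu3 := (@lebesgue3 R).
Variables (Om : set 'rV[R]_3) (n : 'rV[R]_3 -> 'rV[R]_3).
Variable sigma : {measure set (borel3 R) -> \bar R}.
Hypotheses (oOm : open Om) (nOm : outward_unit_normal Om n).
Hypothesis sOm : surface_measure Om sigma.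

Lemma closed_boundary : closed (boundary Om).
Proof.
rewrite /boundary setDE; apply: closedI; first exact: closed_closure.
by apply: open_closedC; exact: open_interior.
Qed.

Lemma measurable_boundary : measurable (@point3 R @^-1` boundary Om).
Proof.
rewrite -[_ @^-1` _]setCK; apply: measurableC; rewrite preimage_setC.
by apply: measurable_point3; apply: closed_openC; exact: closed_boundary.
Qed.

(** A point of the graph is not interior, the side condition being strict, and
    moving it along the axis k by an arbitrarily small amount reaches the
    domain. *)
Lemma chart_boundary U k b g x : graph_chart Om U k b g -> U x ->
  x 0 k = g (x 0 (k + 1), x 0 (k + 2)) -> boundary Om x.
Proof.
move=> [oU _ hU] Ux xg; split; last first.
  by move/interior_subset => /hU -/(_ Ux); rewrite xg subrr mulr0 ltxx.
move=> B xB.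
have /nbhs_ballP[e /= e0 he] : nbhs x (U `&` B) by apply: filterI => //; exact: open_nbhs_nbhs.
(* The domain is on the side of smaller x_k when b is false. *)
pose y := x - ((-1) ^+ b * (e / 2)) *: basis k.
have yi i : y 0 i = x 0 i - (-1) ^+ b * (e / 2) * (i == k)%:R by rewrite !mxE eqxx.
have yk : y 0 k = x 0 k - (-1) ^+ b * (e / 2) by rewrite yi eqxx mulr1.
have [Uy By] : (U `&` B) y.
  apply: he; apply/ball_rV3 => // i; rewrite yi opprB addrC subrK.
  rewrite normrM normrM normr_sign mul1r gtr0_norm ?divr_gt0//.
  by case: (i == k); rewrite ?normr1 ?normr0; lra.
exists y; split => //; apply/(hU _ Uy).
rewrite yk !yi !ord3_rot !mulr0 !subr0 -xg opprB addrC subrK mulrA -signr_addb addbb mul1r.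
by rewrite divr_gt0.
Qed.

Section chart.
Variables (U : set 'rV[R]_3) (k : 'I_3) (b : bool) (g : R * R -> R).
Variables (G : 'rV[R]_3 -> 'rV[R]_3) (K : set 'rV[R]_3) (M : R).
Hypothesis chartU : graph_chart Om U k b g.
Hypotheses (c1G : forall x j, c1 (fun x => G x 0 j) x).
Hypotheses (clK : closed K) (KU : K `<=` U) (KM : K `<=` box M).
Hypothesis G0 : forall x, ~ K x -> G x = 0.

Let pr (x : 'rV[R]_3) : R * R := (x 0 (k + 1), x 0 (k + 2)).

Let c1g y : c1 g y.
Proof. by case: chartU => _ h _; exact: (Ck1_c1 openT h). Qed.

Let area_gt0 y : 0 < area_density g y.
Proof. by rewrite sqrtr_gt0 -addrA ltr_pwDl// addr_ge0 ?sqr_ge0. Qed.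

Let pr_graph y : pr (graph_point k g y) = y.
Proof. by rewrite /pr !graph_point_coord -surjective_pairing. Qed.

(** The normal component of G on the boundary, extended continuously to space
    through the chart, and its density with respect to dy. *)
Let W (x : 'rV[R]_3) : R :=
  (-1) ^+ b / area_density g (pr x) * flux k g G (pr x) x.

Let H (y : R * R) : R := (-1) ^+ b * flux k g G y (graph_point k g y).

Let WH y : W (graph_point k g y) * area_density g y = H y.
Proof.
rewrite /W /H pr_graph mulrAC -[_ / _ * _]mulrA mulVf ?mulr1//.
by rewrite gt_eqF.
Qed.

Let flux0 y x : ~ K x -> flux k g G y x = 0.
Proof. by move=> /G0 h; rewrite /flux h !mxE !mulr0 !subr0. Qed.

Let GnE x : boundary Om x -> dot (G x) (n x) = W x.
Proof.
move=> bx; have [Kx|Kx] := pselect (K x); last first.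
  rewrite /W flux0// mulr0 /dot G0//.
  by rewrite big1 // => i _; rewrite mxE mul0r.
rewrite (nOm chartU (KU Kx) bx) /dot (sum3_rot k) /W /flux -/(pr x).
rewrite !mxE !eqxx !ord3_rot /=.
set c := _ / _; move: ('D_(1, 0) g _) ('D_(0, 1) g _) => g1 g2; ring.
Qed.

Let cpr : continuous pr.
Proof. by apply: pair_continuous; exact: coord_continuous. Qed.

Let cW : continuous W.
Proof.
have cg1 := fun y => (c1g y).2 (1, 0); have cg2 := fun y => (c1g y).2 (0, 1).
have cG j x : {for x, continuous (fun x => G x 0 j)} by exact: c1_continuous.
have cg1p x : {for x, continuous (fun x => 'D_(1, 0) g (pr x))}.
  exact: (for_continuous_comp (@cpr x) (@cg1 _)).
have cg2p x : {for x, continuous (fun x => 'D_(0, 1) g (pr x))}.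
  exact: (for_continuous_comp (@cpr x) (@cg2 _)).
apply: continuous_forP => x; rewrite /W; apply: for_continuousM.
  apply: for_continuousM; first exact: cst_continuous.
  apply: for_continuousV; first by rewrite gt_eqF.
  apply: (for_continuous_comp (h := Num.sqrt)); last exact: sqrt_continuous.
  apply: for_continuousD; first apply: for_continuousD; first exact: cst_continuous.
    exact: (for_continuous_sqr (cg1p x)).
  exact: (for_continuous_sqr (cg2p x)).
rewrite /flux; apply: for_continuousD; first apply: for_continuousD; first exact: cG.
  by apply: for_continuousN; exact: (for_continuousM (cg1p x) (cG _ _)).
by apply: for_continuousN; exact: (for_continuousM (cg2p x) (cG _ _)).
Qed.

(** The normal component multiplied by a = 1 or a = - 1, restricted to the
    boundary and cut off at 0. *)
Let part (a : R) (x : 'rV[R]_3) : \bar R :=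
  ((if x \in boundary Om then Num.max (a * W x) 0 else 0) : R)%:E.

Let measurable_part a : measurable_fun setT (part a \o @point3 R).
Proof.
apply/measurable_EFinP.
rewrite (_ : (fun p => _) = ((fun x => Num.max (a * W x) 0) \o @point3 R) \_ (@point3 R @^-1` boundary Om)); last first.
  by apply/funext => p; rewrite patchE in_preimageE.
apply/(measurable_restrict _ measurable_boundary) => //.
apply: measurable_funTS.
have cm : forall x, {for x, continuous (fun x => Num.max (a * W x) 0)}.
  move=> x; apply: (@continuous_max _ _ (fun x => a * W x) (cst 0)); last exact: cst_continuous.
  by apply: for_continuousM; [exact: cst_continuous|exact: cW].
have := measurable_fun_for_continuous (@measurable_point3 R) (A := setT) (fun x _ => cm x).
by rewrite preimage_setT.
Qed.

Let integral_part (a : R) :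
  (\int[sigma]_p part a (point3 p) = \int[mu2]_y (Num.max (a * H y) 0)%:E)%E.
Proof.
have [_ /(_ U k b g chartU (part a))] := sOm => ->.
- apply: eq_integral => y _; rewrite /part.
  have [Kx|Kx] := pselect (K (graph_point k g y)); last first.
    by rewrite /W /H !flux0// !mulr0 maxxx; case: ifP; rewrite mul0e.
  rewrite ifT; last first.
    rewrite inE; apply: (chart_boundary chartU (KU Kx)).
    by rewrite !graph_point_coord -surjective_pairing.
  by rewrite -EFinM maxr_pMl ?(ltW (area_gt0 _))// -mulrA WH mul0r.
- exact: measurable_part.
- by move=> x; rewrite lee_fin; case: ifP => // _; rewrite le_max lexx orbT.
- move=> x nUx; rewrite /part; case: ifP => // _.
  by rewrite /W flux0 ?mulr0 ?maxxx// => /KU.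
Qed.

(** The divergence theorem for F, with the integrability that makes it
    additive in F. *)
Definition gauss (F : 'rV[R]_3 -> 'rV[R]_3) : Prop :=
  [/\ mu3.-integrable (@point3 R @^-1` Om) (fun p => (divergence F (point3 p))%:E),
      sigma.-integrable (@point3 R @^-1` boundary Om) (fun p => (dot (F (point3 p)) (n (point3 p)))%:E) &
      (\int[mu3]_(p in @point3 R @^-1` Om) (divergence F (point3 p))%:E =
       \int[sigma]_(p in @point3 R @^-1` boundary Om) (dot (F (point3 p)) (n (point3 p)))%:E)%E].

(** A field supported in one chart: the volume integral is an integral over
    one side of a graph. The surface measure is characterised by the integrals
    of nonnegative functions supported in the chart, so the positive and
    negative parts of the normal component are treated separately. *)
Lemma gauss_chart : gauss G.
Proof.
have GM x : ~ box M x -> G x = 0 by move=> nx; apply: G0 => /KM.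
have [iside iH sideH] := @local_divergence_theorem R k b g G M c1g c1G GM.
have div0 x : ~ K x -> divergence G x = 0.
  move=> nK; rewrite /divergence big1// => i _.
  rewrite /partial (@near_eq_derive _ _ _ _ (cst 0)) ?derive_cst//.
  have o : nbhs x (~` K) by apply: open_nbhs_nbhs; split => //; exact: closed_openC.
  by apply: filterS o => z nz; rewrite G0// mxE.
have mOm : measurable (@point3 R @^-1` Om) by exact: measurable_point3.
have mside : measurable (@point3 R @^-1` side k b g).
  by apply: measurable_point3; exact: (@open_side R k b g c1g).
have OmE : (fun p => (divergence G (point3 p))%:E) \_ (@point3 R @^-1` Om) =
    (fun p => (divergence G (point3 p))%:E) \_ (@point3 R @^-1` side k b g).
  apply/funext => p; rewrite !patchE.
  have [Kx|Kx] := pselect (K (point3 p)); last by rewrite div0//; do 2 case: ifP => //.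
  have [_ _ hU] := chartU; have e := hU _ (KU Kx).
  by congr (if _ then _ else _); apply/idP/idP; rewrite !inE => /e.
have iOm : mu3.-integrable (@point3 R @^-1` Om) (fun p => (divergence G (point3 p))%:E).
  by apply/(integrable_mkcond _ mOm); rewrite OmE; apply/(integrable_mkcond _ mside).
have bdE : (fun p => (dot (G (point3 p)) (n (point3 p)))%:E) \_ (@point3 R @^-1` boundary Om)
   = (fun p => part 1 (point3 p) - part (-1) (point3 p))%E.
  apply/funext => p; rewrite patchE /part.
  rewrite in_preimageE; case: ifPn => [|_]; last by rewrite sube0.
  rewrite inE => /GnE ->; rewrite -EFinB mul1r mulN1r; congr (_%:E).
  by rewrite max_subN.
have ge0 a p : (0 <= part a (point3 p))%E.
  by rewrite lee_fin; case: ifP => // _; rewrite le_max lexx orbT.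
have iHa a : mu2.-integrable setT (fun y => (Num.max (a * H y) 0)%:E).
  have := integrable_funepos measurableT (integrableZl measurableT a iH).
  by apply: eq_integrable => // y _; rewrite funepos.unlock -EFinM -EFin_max.
have mpart a : measurable_fun setT (fun p => part a (point3 p)) by exact: measurable_part.
have ipart a : sigma.-integrable setT (fun p => part a (point3 p)).
  apply/integrableP; split => //.
  under eq_integral do rewrite gee0_abs//.
  rewrite integral_part; have /integrableP[_] := iHa a.
  by under eq_integral do rewrite gee0_abs ?lee_fin ?le_max ?lexx ?orbT//.
have ibd : sigma.-integrable (@point3 R @^-1` boundary Om) (fun p => (dot (G (point3 p)) (n (point3 p)))%:E).
  apply/(integrable_mkcond _ measurable_boundary); rewrite bdE.
  exact: integrableB.
split => //.
rewrite [LHS]integral_mkcond OmE -integral_mkcond sideH.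
rewrite [RHS]integral_mkcond bdE integralB// !integral_part -integralB//.
apply: eq_integral => y _; rewrite -EFinB mul1r mulN1r; congr (_%:E); rewrite -/(H y).
by rewrite max_subN.
Qed.

End chart.

Lemma gaussD (F G : 'rV[R]_3 -> 'rV[R]_3) :
  (forall x, Om x -> forall j, differentiable (fun y => F y 0 j) x) ->
  (forall x, Om x -> forall j, differentiable (fun y => G y 0 j) x) ->
  gauss F -> gauss G -> gauss (fun x => F x + G x).
Proof.
move=> dF dG [iF jF eF] [iG jG eG].
have mOm : measurable (@point3 R @^-1` Om) by exact: measurable_point3.
have mbd := measurable_boundary.
have dE p : point3 p \in Om ->
    (divergence (fun x => F x + G x) (point3 p))%:E =
    ((divergence F (point3 p))%:E + (divergence G (point3 p))%:E)%E.
  rewrite inE => Op; rewrite -EFinD /divergence -big_split/=; congr (_%:E).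
  apply: eq_bigr => i _; rewrite /partial.
  rewrite (_ : (fun y => _) = (fun y => F y 0 i) + (fun y => G y 0 i)); last first.
    by apply/funext => y; rewrite mxE.
  by rewrite deriveD//; apply: diff_derivable; [exact: dF|exact: dG].
have sE x : (dot (F x + G x) (n x))%:E = ((dot (F x) (n x))%:E + (dot (G x) (n x))%:E)%E.
  rewrite -EFinD /dot -big_split/=; congr (_%:E).
  by apply: eq_bigr => i _; rewrite mxE mulrDl.
split.
- apply: eq_integrable (integrableD mOm iF iG) => // p pO.
  by rewrite dE//; move: pO; rewrite in_preimageE.
- by apply: eq_integrable (integrableD mbd jF jG) => // p _; rewrite sE.
- transitivity (\int[mu3]_(p in @point3 R @^-1` Om)
      ((divergence F (point3 p))%:E + (divergence G (point3 p))%:E))%E.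
    by apply: eq_integral => p pO; rewrite dE//; move: pO; rewrite in_preimageE.
  rewrite (integralD mOm iF iG) eF eG -(integralD mbd jF jG).
  by apply: eq_integral => p _; rewrite sE.
Qed.

(** The base case of the induction on the covering. *)
Lemma gauss0 (F : 'rV[R]_3 -> 'rV[R]_3) : (forall x, closure Om x -> F x = 0) -> gauss F.
Proof.
move=> F0.
have mOm : measurable (@point3 R @^-1` Om) by exact: measurable_point3.
have mbd := measurable_boundary.
have dE p : p \in @point3 R @^-1` Om -> (divergence F (point3 p))%:E = 0%E.
  rewrite inE /= => Op; rewrite /divergence big1// => i _.
  rewrite /partial (@near_eq_derive _ _ _ _ (cst 0)) ?derive_cst//.
  apply: filterS (open_nbhs_nbhs (conj oOm Op)) => z Oz.
  by rewrite F0 ?mxE//; exact: subset_closure.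
have sE p : p \in @point3 R @^-1` boundary Om -> (dot (F (point3 p)) (n (point3 p)))%:E = 0%E.
  rewrite inE /= => -[cp _]; rewrite /dot big1// => i _.
  by rewrite F0// mxE mul0r.
split.
- by apply: eq_integrable (integrable0 _ _) => // p /dE ->.
- by apply: eq_integrable (integrable0 _ _) => // p /sE ->.
- by rewrite (eq_integral (cst 0%E)) ?integral0// (eq_integral (cst 0%E)) ?integral0.
Qed.

Hypotheses (bOm : bounded_set Om) (C1Om : C1_boundary Om).

(** A neighbourhood of an interior point also has the form of a chart, with a
    constant function whose graph lies above it. The induction on the covering
    then needs no separate case for the interior. *)
Lemma closure_chart x : closure Om x -> exists U k b g, U x /\ graph_chart Om U k b g.
Proof.
move=> cx; have [Ox|nOx] := pselect (Om x); last first.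
  by apply: C1Om; split => // /interior_subset.
have /nbhs_ballP[e /= e0 he] : nbhs x Om by exact: open_nbhs_nbhs.
exists (ball x e), 0, false, (cst (x 0 0 + e)); split; first exact: ballxx.
split; first exact: ball_open.
- have c y := c1_cst (x 0 0 + e : R) (y : (R * R)%type).
  split; first by move=> y _; exact: c1_differentiable.
  by move=> v y _; exact: (c y).2.
- move=> z xz; split => [_|_]; last exact: he.
  rewrite expr0 mul1r /= subr_gt0.
  move/(ball_rV3 _ _ e0) : xz => /(_ 0).
  by rewrite distrC => /(le_lt_trans (ler_norm _)); rewrite ltrBlDl.
Qed.

Section partition.
Variable V : set 'rV[R]_3.
Hypothesis OmV : closure Om `<=` V.

(** The cube of centre cd.1 and half-side cd.2, which supports the bump, lies
    in one chart and in the domain V where the field is regular. *)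
Definition bump_ok (cd : 'rV[R]_3 * R) : Prop :=
  0 < cd.2 /\ exists U k b g, graph_chart Om U k b g /\
    [set x : 'rV[R]_3 | forall i, `|x 0 i - cd.1 0 i| <= cd.2] `<=` U `&` V.

(** Instead of a partition of unity: if B is the bump of the first cube, B F
    is supported in a chart, and (1 - B) F vanishes on that small cube, so the
    remaining small cubes suffice for it. *)
Lemma gauss_partition (l : seq ('rV[R]_3 * R)) :
  (forall cd, cd \in l -> bump_ok cd) ->
  forall F : 'rV[R]_3 -> 'rV[R]_3, (forall x, V x -> forall j, c1 (fun y => F y 0 j) x) ->
  (forall x, closure Om x ->
     (forall cd, cd \in l -> ~ (forall i, `|x 0 i - cd.1 0 i| < cd.2 / 4)) -> F x = 0) ->
  gauss F.
Proof.
elim: l => [|[c d] l IH] lok F c1F F0.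
  by apply: gauss0 => x cx; apply: F0.
have [/= d0 [U [k [b [g [ch KUV]]]]]] := lok (c, d) (mem_head _ _).
pose K : set 'rV[R]_3 := fun x => forall i, `|x 0 i - c 0 i| <= d.
pose B := bump c d.
have bump0 x : ~ K x -> B x = 0.
  move=> nK; apply: bump_eq0 => //; apply: contrapT => h; apply: nK => i.
  by rewrite leNgt; apply/negP => hi; apply: h; exists i; exact: ltW.
have clK : closed K.
  have -> : K = \bigcap_(i in [set: 'I_3]) ((fun x : 'rV[R]_3 => `|x 0 i - c 0 i|) @^-1` [set y | y <= d]).
    by apply/seteqP; split => x h i; [move=> _; exact: h|exact: h].
  apply: closed_bigI => i _; apply: closed_comp => [x _|]; last exact: closed_le.
  have ci : {for x, continuous (fun x : 'rV[R]_3 => x 0 i - c 0 i)}.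
    by apply: for_continuousD; [exact: coord_continuous|exact: cst_continuous].
  exact: (for_continuous_comp ci (@norm_continuous _ _ _)).
have KM : K `<=` box (d + `|c|).
  move=> x Kx i; rewrite -(subrK (c 0 i) (x 0 i)).
  rewrite (le_trans (ler_normD _ _))// lerD//.
  rewrite [leRHS]mx_normrE.
  exact: (le_bigmax _ (fun ij => `|c ij.1 ij.2|) (0, i)).
have cB x : c1 B x by exact: c1_bump.
pose G x := B x *: F x.
have G0 x : ~ K x -> G x = 0 by move=> /bump0 h; rewrite /G h scale0r.
have c1G x j : c1 (fun y => G y 0 j) x.
  have [Kx|nKx] := pselect (K x).
    rewrite (_ : (fun y => _) = fun y => B y * F y 0 j).
      exact: (c1M (cB x) (c1F x (KUV _ Kx).2 j)).
    by apply/funext => y; rewrite /G mxE.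
  apply: (near_eq_c1 _ (c1_cst (0 : R) x)).
  have o : nbhs x (~` K) by apply: open_nbhs_nbhs; split => //; exact: closed_openC.
  by apply: filterS o => y /G0 ->; rewrite mxE.
have gG : gauss G.
  by apply: (gauss_chart ch c1G clK _ KM G0) => x /KUV [].
have c1B' x : c1 (fun y => 1 - B y) x by apply: c1B; [exact: c1_cst|exact: cB].
pose F' x := (1 - B x) *: F x.
have c1F' x : V x -> forall j, c1 (fun y => F' y 0 j) x.
  move=> Vx j; rewrite (_ : (fun y => _) = fun y => (1 - B y) * F y 0 j).
    exact: (c1M (c1B' x) (c1F x Vx j)).
  by apply/funext => y; rewrite /F' mxE.
have gF' : gauss F'.
  apply: IH => //.
  - by move=> cd cdl; apply: lok; rewrite inE cdl orbT.
  - move=> x cx hl; have [hx|hx] := pselect (forall i, `|x 0 i - c 0 i| < d / 4).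
      by rewrite /F' /B bump_eq1// subrr scale0r.
    rewrite /F' F0 ?scaler0// => cd; rewrite inE => /predU1P[-> //|]; exact: hl.
rewrite (_ : F = fun x => G x + F' x); last first.
  by apply/funext => x; rewrite /G /F' -scalerDl addrC subrK scale1r.
have OV x : Om x -> V x by move=> Ox; apply: OmV; exact: subset_closure.
apply: gaussD => // x Ox j; apply: c1_differentiable; first exact: c1G.
by apply: c1F'; exact: OV.
Qed.

End partition.

(** By compactness, finitely many small cubes, each inside a chart, cover the
    closure. *)
Theorem gauss_theorem (V : set 'rV[R]_3) (F : 'rV[R]_3 -> 'rV[R]_3) : open V -> closure Om `<=` V ->
  (forall x, V x -> forall j, c1 (fun y => F y 0 j) x) -> gauss F.
Proof.
move=> oV OmV c1F.
have ex x : closure Om x -> exists d, bump_ok V (x, d).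
  move=> cx; have [U [k [b [g [Ux ch]]]]] := closure_chart cx.
  have [oU _ _] := ch.
  have /nbhs_ballP[e /= e0 he] : nbhs x (U `&` V).
    by apply: filterI; apply: open_nbhs_nbhs; split => //; exact: OmV.
  exists (e / 2); split; first by rewrite /= divr_gt0.
  exists U, k, b, g; split => // z hz; apply: he; apply/ball_rV3 => // i.
  by have := hz i; rewrite /= distrC; lra.
(* A choice of half-side at every point; the default 1 is never used on the
   closure of the domain. *)
pose d x := xget 1 [set d | bump_ok V (x, d)].
have dok x : closure Om x -> bump_ok V (x, d x).
  by move=> /ex [d0 h]; rewrite /d; case: xgetP => [? -> //|/(_ d0)].
have := compact_closure bOm; rewrite compact_cover => /(_ 'rV[R]_3 (closure Om)
   (fun c => ball c (d c / 4))).
case.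
- move=> c /dok[/= d0 _]; apply: ball_open; exact: divr_gt0.
- by move=> x cx; exists x => //; apply: ballxx; have [] := dok _ cx; rewrite /= => ? _; rewrite divr_gt0.
move=> D' D'sub cov.
apply: (gauss_partition OmV (l := [seq (c, d c) | c <- finmap.enum_fset D'])) => //.
  by move=> cd /mapP[c cD ->]; apply: dok; have := D'sub c cD; rewrite inE.
move=> x cx hx; exfalso.
have [c cD xc] := cov x cx.
have cD' : c \in finmap.enum_fset D' := cD.
apply: (hx (c, d c)); first by apply/mapP; exists c.
have cc : closure Om c by have := D'sub c cD'; rewrite inE.
have [d0 _] := dok _ cc.
move/ball_rV3 : xc => /(_ ltac:(by rewrite divr_gt0)) h i.
by rewrite distrC; exact: h.
Qed.

End surface.

(** * Vector calculus *)

Section vector_calculus.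
Context {R : realType}.
Implicit Types u v w : 'rV[R]_3.

Lemma ord3D : ((0 + 1 = 1 :> 'I_3) * (0 + 2 = 2 :> 'I_3) * (1 + 1 = 2 :> 'I_3) *
  (1 + 2 = 0 :> 'I_3) * (2 + 1 = 0 :> 'I_3) * (2 + 2 = 1 :> 'I_3)).
Proof. by do !split; exact: val_inj. Qed.

Lemma sum3E (V : zmodType) (f : 'I_3 -> V) : \sum_i f i = f 0 + f 1 + f 2.
Proof. by rewrite (sum3_rot 0) !ord3D. Qed.

Lemma dotE u v : dot u v = u 0 0 * v 0 0 + u 0 1 * v 0 1 + u 0 2 * v 0 2.
Proof. by rewrite /dot sum3E. Qed.

Lemma crossE u v :
  ((cross u v 0 0 = u 0 1 * v 0 2 - u 0 2 * v 0 1) *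
   (cross u v 0 1 = u 0 2 * v 0 0 - u 0 0 * v 0 2) *
   (cross u v 0 2 = u 0 0 * v 0 1 - u 0 1 * v 0 0)).
Proof. by rewrite /cross !mxE !ord3D. Qed.

(** The triple product, which turns the normal component of K x H into
    K . (H x n). *)
Lemma dot_crossA u v w : dot (cross u v) w = dot u (cross v w).
Proof. by rewrite !dotE !crossE; ring. Qed.

Lemma dot_cross_swap u v w : dot (cross u v) w = - dot (cross w v) u.
Proof. by rewrite !dotE !crossE; ring. Qed.

Lemma dot_cross_id u v : dot (cross u v) u = 0.
Proof. by rewrite !dotE !crossE; ring. Qed.

Lemma dotC u v : dot u v = dot v u.
Proof. by rewrite !dotE; ring. Qed.

Lemma dotDl u v w : dot (u + v) w = dot u w + dot v w.
Proof. by rewrite !dotE !mxE; ring. Qed.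

Lemma dotZl (a : R) u v : dot (a *: u) v = a * dot u v.
Proof. by rewrite !dotE !mxE; ring. Qed.

Lemma dotNl u v : dot (- u) v = - dot u v.
Proof. by rewrite !dotE !mxE; ring. Qed.

Lemma normsqZ (a : R) u : normsq (a *: u) = a ^+ 2 * normsq u.
Proof. by rewrite /normsq dotZl dotC dotZl expr2 mulrA. Qed.

Lemma normsq_ge0 u : 0 <= normsq u.
Proof. by rewrite /normsq /dot sumr_ge0// => i _; rewrite -expr2 sqr_ge0. Qed.

(** Differentiability by components, the form in which the curl and the
    divergence use it. *)
Definition cdiff (F : 'rV[R]_3 -> 'rV[R]_3) x := forall j, differentiable (fun y => F y 0 j) x.

Lemma partialM i (f g : 'rV[R]_3 -> R) x : differentiable f x -> differentiable g x ->
  partial i (fun y => f y * g y) x = f x * partial i g x + g x * partial i f x.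
Proof.
by move=> df dg; rewrite /partial (@deriveM _ _ f g)//; exact: diff_derivable.
Qed.

Lemma partialB i (f g : 'rV[R]_3 -> R) x : differentiable f x -> differentiable g x ->
  partial i (fun y => f y - g y) x = partial i f x - partial i g x.
Proof.
by move=> df dg; rewrite /partial (@deriveB _ _ _ f g)//; exact: diff_derivable.
Qed.

Lemma partialZ i (a : R) (f : 'rV[R]_3 -> R) x : differentiable f x ->
  partial i (fun y => a * f y) x = a * partial i f x.
Proof.
by move=> df; rewrite /partial (@deriveZ _ _ _ f)//; exact: diff_derivable.
Qed.

Lemma curlE (F : 'rV[R]_3 -> 'rV[R]_3) x :
  ((curl F x 0 0 = partial 1 (fun y => F y 0 2) x - partial 2 (fun y => F y 0 1) x) *
   (curl F x 0 1 = partial 2 (fun y => F y 0 0) x - partial 0 (fun y => F y 0 2) x) *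
   (curl F x 0 2 = partial 0 (fun y => F y 0 1) x - partial 1 (fun y => F y 0 0) x)).
Proof. by rewrite /curl !mxE !ord3D. Qed.

Lemma divergence_cross (K H : 'rV[R]_3 -> 'rV[R]_3) x : cdiff K x -> cdiff H x ->
  divergence (fun y => cross (K y) (H y)) x =
  dot (H x) (curl K x) - dot (K x) (curl H x).
Proof.
move=> dK dH; rewrite /divergence sum3E !dotE !curlE.
have E0 : (fun y => cross (K y) (H y) 0 0) = fun y => K y 0 1 * H y 0 2 - K y 0 2 * H y 0 1.
  by apply/funext => y; rewrite crossE.
have E1 : (fun y => cross (K y) (H y) 0 1) = fun y => K y 0 2 * H y 0 0 - K y 0 0 * H y 0 2.
  by apply/funext => y; rewrite crossE.
have E2 : (fun y => cross (K y) (H y) 0 2) = fun y => K y 0 0 * H y 0 1 - K y 0 1 * H y 0 0.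
  by apply/funext => y; rewrite crossE.
have dM i j : differentiable (fun y => K y 0 i * H y 0 j) x.
  exact: (differentiableM (dK i) (dH j)).
rewrite E0 E1 E2 !partialB// !partialM//.
do 12 move: (partial _ _ _) => ?.
do 3 move: (K x 0 _) => ?; do 3 move: (H x 0 _) => ?.
ring.
Qed.

Lemma curlZB (a : R) (C A : 'rV[R]_3 -> 'rV[R]_3) x : cdiff C x -> cdiff A x ->
  curl (fun y => a *: (C y - A y)) x = a *: (curl C x - curl A x).
Proof.
move=> dC dA; apply/rowP => i; rewrite /curl !mxE.
have E j : (fun y => (a *: (C y - A y)) 0 j) = fun y => a * (C y 0 j - A y 0 j).
  by apply/funext => y; rewrite !mxE.
have d j : differentiable (fun y => C y 0 j - A y 0 j) x.
  exact: (differentiableB (dC j) (dA j)).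
rewrite !E !partialZ// !partialB//; ring.
Qed.

Lemma for_continuous_coord (T : topologicalType) (F : T -> 'rV[R]_3) (x : T) j :
  {for x, continuous F} -> {for x, continuous (fun y => F y 0 j)}.
Proof.
move=> cF; apply: (for_continuous_comp (f := F) (h := fun N : 'rV[R]_3 => N 0 j) cF).
exact: coord_continuous.
Qed.

Lemma for_continuous_dot (T : topologicalType) (F G : T -> 'rV[R]_3) (x : T) :
  (forall j, {for x, continuous (fun y => F y 0 j)}) ->
  (forall j, {for x, continuous (fun y => G y 0 j)}) ->
  {for x, continuous (fun y => dot (F y) (G y))}.
Proof.
move=> cF cG; rewrite (_ : (fun y => _) = fun y => F y 0 0 * G y 0 0 + F y 0 1 * G y 0 1
    + F y 0 2 * G y 0 2); last by apply/funext => y; rewrite dotE.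
by apply: for_continuousD; [apply: for_continuousD|]; exact: for_continuousM.
Qed.

(** The C^1 condition by components, in the form required by the divergence
    theorem. *)
Definition c1v (V : normedModType R) (F : V -> 'rV[R]_3) (x : V) : Prop :=
  forall j, c1 (fun y => F y 0 j) x.

Section c1v.
Variable V : normedModType R.
Implicit Types (a : V -> R) (F G : V -> 'rV[R]_3) (x : V).

Lemma c1_c1v F x : c1 F x -> c1v F x.
Proof. by move=> cF j; exact: (c1_coord (F := F) j cF). Qed.

Lemma c1vD F G x : c1v F x -> c1v G x -> c1v (fun y => F y + G y) x.
Proof.
move=> cF cG j; rewrite (_ : (fun y => _) = fun y => F y 0 j + G y 0 j).
  exact: c1D (cF j) (cG j).
by apply/funext => y; rewrite mxE.
Qed.

Lemma c1vB F G x : c1v F x -> c1v G x -> c1v (fun y => F y - G y) x.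
Proof.
move=> cF cG j; rewrite (_ : (fun y => _) = fun y => F y 0 j - G y 0 j).
  exact: c1B (cF j) (cG j).
by apply/funext => y; rewrite !mxE.
Qed.

Lemma c1vZ a F x : c1 a x -> c1v F x -> c1v (fun y => a y *: F y) x.
Proof.
move=> ca cF j; rewrite (_ : (fun y => _) = fun y => a y * F y 0 j).
  exact: c1M ca (cF j).
by apply/funext => y; rewrite mxE.
Qed.

Lemma c1v_cross F G x : c1v F x -> c1v G x -> c1v (fun y => cross (F y) (G y)) x.
Proof.
move=> cF cG j.
rewrite (_ : (fun y => _) = fun y => F y 0 (j + 1) * G y 0 (j + 2) - F y 0 (j + 2) * G y 0 (j + 1)).
  exact: c1B (c1M (cF _) (cG _)) (c1M (cF _) (cG _)).
by apply/funext => y; rewrite /cross mxE.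
Qed.

Lemma c1v_slice (F : V * R -> 'rV[R]_3) x t : c1v F (x, t) -> c1v (fun y => F (y, t)) x.
Proof. by move=> cF j; exact: (c1_slice (F := fun p => F p 0 j) (cF j)). Qed.

End c1v.

Lemma c1v_cdiff F x : c1v F x -> cdiff F x.
Proof. by move=> cF j; exact: c1_differentiable (cF j). Qed.

Lemma is_derive_normsq (F : R -> 'rV[R]_3) (t : R) : differentiable F t ->
  is_derive t (1 : R) (fun t => normsq (F t)) (2 * dot (F t) (derive1 F t)).
Proof.
move=> dF.
have dj j : is_derive t (1 : R) (fun t => F t 0 j) (derive1 F t 0 j).
  apply: DeriveDef; last by rewrite derive1E derive_coord.
  apply: diff_derivable.
  exact: (@differentiable_comp _ _ _ _ F (fun N : 'rV[R]_3 => N 0 j) t dF (differentiable_coord _ _ _)).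
have -> : (fun t => normsq (F t)) = (fun t => F t 0 0) * (fun t => F t 0 0) +
   (fun t => F t 0 1) * (fun t => F t 0 1) + (fun t => F t 0 2) * (fun t => F t 0 2).
  by apply/funext => z; rewrite /normsq dotE.
have h := is_deriveD (is_deriveD (is_deriveM (dj 0) (dj 0)) (is_deriveM (dj 1) (dj 1)))
   (is_deriveM (dj 2) (dj 2)).
apply: (is_derive_eq h); rewrite dotE /GRing.scale/=; ring.
Qed.

End vector_calculus.

(** * Integrals in space and time *)

(** A function continuous at every point of a compact set is bounded there. *)
Lemma integrable_on_compact d (T : measurableType d) (R : realType)
    (mu : {measure set T -> \bar R}) (V : topologicalType) (phi : T -> V)
    (K A : set V) (f : V -> R) :
  (forall O, open O -> measurable (phi @^-1` O)) ->
  compact K -> A `<=` K -> measurable (phi @^-1` A) -> (mu (phi @^-1` A) < +oo)%E ->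
  (forall x, K x -> {for x, continuous f}) ->
  mu.-integrable (phi @^-1` A) (fun t => (f (phi t))%:E).
Proof.
move=> mphi cK AK mA muA cf.
apply: (@measurable_bounded_integrable _ _ _ mu (f \o phi)) => //.
  by apply: measurable_fun_for_continuous => // x /AK; exact: cf.
have cfK : compact (f @` K).
  apply: continuous_compact => //; apply/continuous_in_subspaceT => x.
  by rewrite inE; exact: cf.
have [M [Mr hM]] := compact_bounded cfK.
by exists M; split => // x Mx t At; apply: (hM _ Mx); exists (phi t) => //; exact: AK.
Qed.

Section FTC_segment.
Context {R : realType}.
Variables (a b : R) (phi dphi : R -> R).
Hypotheses (ab : a < b).
Hypothesis dphiE : forall t : R, a <= t <= b -> is_derive t (1 : R) phi (dphi t).

Lemma is_derive_within : {within `[a, b], continuous phi}.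
Proof.
apply: derivable_within_continuous => t; rewrite in_itv/= => tab.
by have [] := dphiE tab.
Qed.

Lemma FTC_segment : (forall t, a <= t <= b -> {for t, continuous dphi}) ->
  \int[@lebesgue_measure R]_(t in `[a, b]) dphi t = phi b - phi a.
Proof.
move=> cdphi; rewrite /Rintegral (continuous_FTC2 (F := phi) ab) //.
- by apply/continuous_in_subspaceT => t; rewrite inE/= in_itv/=; exact: cdphi.
- have c t : a <= t <= b -> {for t, continuous phi}.
    move=> tab; apply: differentiable_continuous; apply/derivable1_diffP.
    by have [] := dphiE tab.
  split.
  + by move=> t; rewrite in_itv/= => /andP[/ltW ta /ltW tb];
    have [] // : is_derive t (1 : R) phi (dphi t) by apply: dphiE; apply/andP.
  + by apply: cvg_at_right_filter; apply: c; rewrite lexx ltW.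
  + by apply: cvg_at_left_filter; apply: c; rewrite lexx ltW.
- move=> t; rewrite in_itv/= => /andP[/ltW ta /ltW tb]; rewrite derive1E.
  by apply: derive_val; apply: dphiE; apply/andP.
Qed.

Lemma derive_ge0_le : (forall t, a <= t <= b -> 0 <= dphi t) -> phi a <= phi b.
Proof.
move=> d0; have [c] : exists2 c, c \in `]a, b[ & phi b - phi a = dphi c * (b - a).
  apply: MVT => //; last exact: is_derive_within.
  by move=> t; rewrite in_itv/= => /andP[/ltW ta /ltW tb]; apply: dphiE; apply/andP.
rewrite in_itv/= => /andP[/ltW ac /ltW cb] e.
by rewrite -subr_ge0 e mulr_ge0 ?subr_ge0 ?(ltW ab)// d0// ac.
Qed.

End FTC_segment.

Section space_time.
Context {R : realType}.
Local Notation mu1 := (@lebesgue_measure R).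
Local Notation mu3 := (@lebesgue3 R).
Variables (Om : set 'rV[R]_3) (t1 t2 : R).
Hypotheses (oOm : open Om) (bOm : bounded_set Om).

Let I : set R := `[t1, t2].
Let Q := closure Om `*` I.
Let phi (p : measurableTypeR R * borel3 R) : 'rV[R]_3 * R := (point3 p.2, p.1).

Let mOm : measurable (@point3 R @^-1` Om).
Proof. exact: measurable_point3. Qed.

Lemma lebesgue3_bounded : (mu3 (@point3 R @^-1` Om) < +oo)%E.
Proof.
have [M hM] := bounded_sub_box bOm.
apply: (@le_lt_trans _ _ (mu3 (@point3 R @^-1` box M))).
  apply: le_measure; rewrite ?inE//; first exact: measurable_box.
  by move=> p; exact: hM.
exact: lebesgue3_box.
Qed.

Lemma integrable_bounded (f : 'rV[R]_3 -> R) :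
  (forall x, closure Om x -> {for x, continuous f}) ->
  mu3.-integrable (@point3 R @^-1` Om) (fun p => (f (point3 p))%:E).
Proof.
move=> cf; apply: (integrable_on_compact (K := closure Om)) => //.
- exact: measurable_point3.
- exact: compact_closure.
- exact: subset_closure.
- exact: lebesgue3_bounded.
Qed.

Let compactQ : compact Q.
Proof. by apply: compact_setX; [exact: compact_closure|exact: segment_compact]. Qed.

Let A : set (measurableTypeR R * borel3 R) := phi @^-1` (Om `*` I).

Let AE : A = I `*` (@point3 R @^-1` Om).
Proof. by apply/seteqP; split => p []. Qed.

Let mI : measurable (I : set (measurableTypeR R)).
Proof. exact: measurable_itv. Qed.

Let mA : measurable A.
Proof. by rewrite AE; exact: measurableX. Qed.

Variable h : 'rV[R]_3 -> R -> R.
Hypothesis ch : forall p, Q p -> {for p, continuous (fun p => h p.1 p.2)}.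

Let hh p := (h (point3 p.2) p.1)%:E.

Let ihh : (mu1 \x mu3)%E.-integrable A hh.
Proof.
apply: (@integrable_on_compact _ _ _ (mu1 \x mu3)%E _ phi Q (Om `*` I) (fun p => h p.1 p.2)) => //.
- move=> O /measurable_point3_time mO.
  have := @measurable_swap _ _ (measurableTypeR R) (borel3 R) measurableT _ mO.
  by rewrite setTI.
- by move=> [x t] [Ox It]; split => //; exact: subset_closure.
- rewrite -/A AE.
  rewrite [X in (X < _)%E](_ : _ = (mu1 I * mu3 (@point3 R @^-1` Om))%E); last exact: product_measure1E.
  rewrite lte_mul_pinfty ?measure_ge0//; last exact: lebesgue3_bounded.
  by rewrite /I lebesgue_measure_itv/=; case: ifP.
Qed.

Let iA : (mu1 \x mu3)%E.-integrable setT (hh \_ A).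
Proof. exact/(integrable_mkcond _ mA). Qed.

Let slice_time t : I t -> (fun p => (hh \_ A) (t, p)) = (fun p => (h (point3 p) t)%:E) \_ (@point3 R @^-1` Om).
Proof.
move=> It; apply/funext => p; rewrite !patchE; congr (if _ then _ else _).
by apply/idP/idP; rewrite !inE => // -[].
Qed.

Let slice_time0 t : ~ I t -> (fun p => (hh \_ A) (t, p)) = cst 0%E.
Proof.
by move=> It; apply/funext => p; rewrite patchE memNset// => -[].
Qed.

Let slice_space p : (fun t => (hh \_ A) (t, p)) =
  (if p \in @point3 R @^-1` Om then (fun t => (h (point3 p) t)%:E) \_ I else cst 0%E).
Proof.
apply/funext => t; have [Op|Op] := pselect (Om (point3 p)); last first.
  by rewrite patchE !memNset// => -[].
rewrite [in RHS]mem_set//; rewrite !patchE; congr (if _ then _ else _).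
by apply/idP/idP; rewrite !inE => // -[].
Qed.

Lemma time_slice_continuous x t : closure Om x -> I t -> {for t, continuous (h x)}.
Proof.
move=> cx It.
exact: (for_continuous_slice2 (h := fun p => h p.1 p.2) (ch (p := (x, t)) (conj cx It))).
Qed.

Lemma space_slice_continuous x t : closure Om x -> I t -> {for x, continuous (h ^~ t)}.
Proof.
move=> cx It.
exact: (for_continuous_slice (h := fun p => h p.1 p.2) (ch (p := (x, t)) (conj cx It))).
Qed.

Let vol t : I t -> (\int[mu3]_(p in @point3 R @^-1` Om) (h (point3 p) t)%:E)%E =
  (volume_integral Om (h ^~ t))%:E.
Proof.
move=> It; rewrite /volume_integral /Rintegral fineK//; apply: integrable_fin_num => //.
apply: (@integrable_bounded (h ^~ t)) => x cx; exact: space_slice_continuous.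
Qed.

Let tim x : closure Om x -> (\int[mu1]_(t in I) (h x t)%:E)%E = (time_integral t1 t2 (h x))%:E.
Proof.
move=> cx; rewrite /time_integral /Rintegral fineK//; apply: integrable_fin_num => //.
apply: continuous_compact_integrable; first exact: segment_compact.
by apply/continuous_in_subspaceT => t; rewrite inE => It; exact: time_slice_continuous.
Qed.

Let fubini_slice t : fubini_F mu3 (hh \_ A) t =
  ((fun t => (volume_integral Om (h ^~ t))%:E) \_ I) t.
Proof.
rewrite /fubini_F patchE; have [It|It] := pselect (I t).
  by rewrite mem_set// -vol// [RHS]integral_mkcond -(slice_time It).
rewrite memNset//; have := slice_time0 It; rewrite funeqE => e.
by under eq_integral do rewrite e; rewrite integral0.
Qed.

Lemma integrable_volume_integral :
  mu1.-integrable I (fun t => (volume_integral Om (h ^~ t))%:E).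
Proof.
apply/(integrable_mkcond _ mI).
have := integrable_fubini_F iA; by apply: eq_integrable => // t _; exact: fubini_slice.
Qed.

(** Fubini for a function continuous on the compact cylinder, hence bounded on
    a set of finite measure. *)
Lemma swap_space_time :
  volume_integral Om (fun x => time_integral t1 t2 (h x)) =
  time_integral t1 t2 (fun t => volume_integral Om (h ^~ t)).
Proof.
rewrite {1}/volume_integral {2}/time_integral /Rintegral; congr fine.
transitivity (\int[mu3]_x fubini_G mu1 (hh \_ A) x)%E.
  rewrite [LHS]integral_mkcond; apply: eq_integral => p _.
  rewrite /fubini_G; under [RHS]eq_integral do rewrite -[(hh \_ A) _]/((fun t => (hh \_ A) (t, p)) _).
  rewrite slice_space patchE; case: ifPn => Op; last by rewrite integral0.
  rewrite -integral_mkcond tim//; apply: subset_closure.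
  by move: Op; rewrite inE.
rewrite integral21_prod_meas1// -integral12_prod_meas1//.
rewrite [RHS]integral_mkcond; apply: eq_integral => t _.
exact: fubini_slice.
Qed.

End space_time.

(** * Monotonicity of entropy and temperature under heating *)

Section entropy.
Context {R : realType}.

Lemma Ck1_on_closed (V W : normedModType R) (A : set V) (f : V -> W) :
  Ck_on_closed 1 A f -> exists U, [/\ open U, A `<=` U & forall p, U p -> c1 f p].
Proof. by move=> [U [oU AU h]]; exists U; split => //; exact: Ck1_c1 h. Qed.

Lemma Ck2_on_closed (V W : normedModType R) (A : set V) (f : V -> W) :
  Ck_on_closed 2 A f -> exists U, [/\ open U, A `<=` U &
    forall p, U p -> c1 f p /\ forall v, c1 ('D_v f) p].
Proof.
move=> [U [oU AU [df h]]]; exists U; split => // p Up.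
have c v : c1 ('D_v f) p by exact: (Ck1_c1 oU (h v)).
split => //; split; last by move=> v; exact: c1_continuous (c v).
by apply: filterS (open_nbhs_nbhs (conj oU Up)) => y; exact: df.
Qed.

Lemma derive_along_energy (k : R * R -> R) (w : R) (eps : R -> R) (t d : R) :
  is_derive t (1 : R) eps d -> differentiable k (w, eps t) ->
  is_derive t (1 : R) (fun t => k (w, eps t)) (d * ds_de k (w, eps t)).
Proof.
move=> deps dk.
have de : differentiable eps t by apply/derivable1_diffP; have [] := deps.
have dp : differentiable (fun t => (w, eps t)) t.
  by apply: differentiable_pair => //; exact: differentiable_cst.
apply: DeriveDef.
  apply: diff_derivable.
  exact: (@differentiable_comp _ _ _ _ (fun t => (w, eps t)) k).
rewrite (@derive_comp _ _ _ _ (fun t => (w, eps t)) k)//.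
rewrite (@derive_pair _ _ _ _ (cst w) eps)//.
rewrite derive_cst (@derive_val _ _ _ _ _ _ _ deps).
have -> : (0, d) = d *: (0, 1) + 0 :> R * R.
  by rewrite addr0; congr (_, _); rewrite /GRing.scale/= ?mulr0 ?mulr1.
by rewrite derive_lincomb// derive0 addr0.
Qed.

(** By the chain rule s and ds/de have along the path the derivatives
    eps' ds/de and eps' d^2s/de^2, whose signs are given by positivity of the
    temperature and concavity. *)
Lemma entropy_monotone (D : set (R * R)) (s : R * R -> R) (w a b : R) (eps deps : R -> R) :
  equation_of_state D s -> a < b ->
  (forall t, a <= t <= b -> is_derive t (1 : R) eps (deps t)) ->
  (forall t, a <= t <= b -> 0 <= deps t) ->
  (forall t, a <= t <= b -> D (w, eps t)) ->
  0 < ds_de s (w, eps b) <= ds_de s (w, eps a) /\ s (w, eps a) <= s (w, eps b).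
Proof.
move=> [[oD _ _] _ [ds d2s] se_gt0 conc] ab epsE deps0 Deps.
split.
  rewrite se_gt0/=; last by apply: Deps; rewrite (ltW ab) lexx.
  have h : forall t, a <= t <= b -> is_derive t (1 : R) (fun t => - ds_de s (w, eps t))
     (- (deps t * ds_de (ds_de s) (w, eps t))).
    move=> t tab; apply: is_deriveN; apply: derive_along_energy; first exact: epsE.
    by have [h _] := d2s (0, 1); exact: h _ (Deps _ tab).
  rewrite -lerN2; apply: (derive_ge0_le ab h) => t tab.
  by rewrite oppr_ge0 mulr_ge0_le0 ?deps0//; have [] := conc _ (Deps _ tab).
have h : forall t, a <= t <= b -> is_derive t (1 : R) (fun t => s (w, eps t))
     (deps t * ds_de s (w, eps t)).
  move=> t tab; apply: derive_along_energy; first exact: epsE.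
  exact: ds _ (Deps _ tab).
apply: (derive_ge0_le ab h) => t tab.
by rewrite mulr_ge0 ?deps0// ltW// se_gt0//; exact: Deps.
Qed.

End entropy.

(** The components of the curl are partial derivatives of a C^2 field, seen as
    derivatives of the joint function of space and time. *)
Lemma c1_curl (R : realType) (H : 'rV[R]_3 -> R -> 'rV[R]_3) (p : 'rV[R]_3 * R) :
  c1 (fun p => H p.1 p.2) p -> (forall w, c1 ('D_w (fun p => H p.1 p.2)) p) ->
  c1v (fun p => curl (H ^~ p.2) p.1) p.
Proof.
move=> cF cdF j; pose F (p : 'rV[R]_3 * R) := H p.1 p.2.
apply: (@near_eq_c1 _ _ _ (fun p => 'D_(basis (j + 1), 0) F p 0 (j + 2)
    - 'D_(basis (j + 2), 0) F p 0 (j + 1))).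
  apply: filterS (cF.1) => -[y s] dF; rewrite /curl mxE /partial/=.
  have d : differentiable (fun y => F (y, s)) y.
    by apply: (@differentiable_comp _ _ _ _ (fun y => (y, s)) F).
  have e1 i k : 'D_(basis i) (fun y => H y s 0 k) y = 'D_(basis i, 0) F (y, s) 0 k.
    by rewrite -derive_slice// -derive_coord.
  by rewrite !e1.
by apply: c1B; apply: c1_coord; exact: cdF.
Qed.

(** * Solutions of the system *)

Section solution.
Context {R : realType}.
Variables (Om : set 'rV[R]_3) (mu r di t1 t2 : R).
Variables (rho : 'rV[R]_3 -> R -> R) (m : 'rV[R]_3 -> R -> 'rV[R]_3).
Variables (E : 'rV[R]_3 -> R -> R) (H : 'rV[R]_3 -> R -> 'rV[R]_3).
Let v := velocity rho m.
Let e := internal_energy rho m E.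
Let J (x : 'rV[R]_3) (t : R) := curl (H ^~ t) x.
Let Q := closure Om `*` `[t1, t2].
Hypotheses (oOm : open Om) (r0 : 0 <= r) (t12 : t1 < t2).
Hypotheses (Crho : Ck_on_closed 1 Q (fun p => rho p.1 p.2))
  (Cm : Ck_on_closed 1 Q (fun p => m p.1 p.2))
  (CE : Ck_on_closed 1 Q (fun p => E p.1 p.2))
  (CH : Ck_on_closed 2 Q (fun p => H p.1 p.2)).
Hypothesis rho_bd : forall x, boundary Om x -> rho x t1 != 0.
Hypothesis rho_gt0 : forall x, Om x -> 0 < rho x t1.
Hypothesis eqns : forall x t, Om x -> t1 <= t <= t2 ->
    [/\ derive1 (rho x) t = 0,
        derive1 (m x) t - mu *: cross (J x t) (H x t) = 0,
        derive1 (E x) t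
          - mu * dot (cross (J x t) (H x t)) ((rho x t)^-1 *: m x t)
          - r * normsq (J x t) = 0 &
        derive1 (H x) t
          - curl (fun y => cross ((rho y t)^-1 *: m y t) (H y t)) x
          + curl (fun y => (r / mu) *: J y t
                    + (di / rho y t) *: cross (J y t) (H y t)) x = 0].

Let QP x t : closure Om x -> t1 <= t <= t2 -> Q (x, t).
Proof. by move=> cx tt; split => //=; rewrite in_itv. Qed.

Let subO x : Om x -> closure Om x. Proof. exact: subset_closure. Qed.

Let c1rho p : Q p -> c1 (fun p => rho p.1 p.2) p.
Proof. by have [U [_ QU h]] := Ck1_on_closed Crho; move=> /QU; exact: h. Qed.

Let c1m p : Q p -> c1 (fun p => m p.1 p.2) p.
Proof. by have [U [_ QU h]] := Ck1_on_closed Cm; move=> /QU; exact: h. Qed.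

Let c1E p : Q p -> c1 (fun p => E p.1 p.2) p.
Proof. by have [U [_ QU h]] := Ck1_on_closed CE; move=> /QU; exact: h. Qed.

Let c1H p : Q p -> c1 (fun p => H p.1 p.2) p /\ forall w, c1 ('D_w (fun p => H p.1 p.2)) p.
Proof. by have [U [_ QU h]] := Ck2_on_closed CH; move=> /QU; exact: h. Qed.

Let rho_cst x t : Om x -> t1 <= t <= t2 -> rho x t = rho x t1.
Proof.
move=> Ox /andP[t1t tt2]; have [<-//|ne] := eqVneq t1 t.
have lt1 : t1 < t by rewrite lt_neqAle ne.
have d s : t1 <= s <= t -> is_derive s (1 : R) (rho x) 0.
  move=> /andP[s1 s2]; have st : t1 <= s <= t2 by rewrite s1 (le_trans s2).
  have [ds e1] := derive1_slice (c1_differentiable (c1rho (QP (subO Ox) st))).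
  apply: DeriveDef; first exact: ds.
  by rewrite -derive1E; have [] := eqns Ox st.
have h1 := derive_ge0_le lt1 d (fun _ _ => lexx 0).
have h2 := derive_ge0_le lt1 (fun s hs => is_deriveN (d s hs)) ltac:(by move=> *; rewrite oppr0).
by apply/eqP; rewrite eq_le h1 andbT; rewrite -lerN2.
Qed.

(** The mass equation holds in the open set only; on the boundary the density
    is constant in time by continuity. *)
Let rho_cst_closure x t : closure Om x -> t1 <= t <= t2 -> rho x t = rho x t1.
Proof.
move=> cx tt; apply/eqP; rewrite -subr_eq0; apply/eqP; apply: contrapT => ne.
have tt1 : t1 <= t1 <= t2 by rewrite lexx ltW.
have c s : t1 <= s <= t2 -> {for x, continuous (fun x => rho x s)}.
  move=> st; apply: c1_continuous.
  exact: (c1_slice (F := fun p => rho p.1 p.2) (c1rho (QP cx st))).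
have cB : {for x, continuous (fun x => rho x t - rho x t1)}.
  by apply: for_continuousD; [exact: c|apply: for_continuousN; exact: c].
(* A point of the domain near x would contradict constancy there. *)
have [y [Oy]] := cx _ (near_neq0 (f := fun x => rho x t - rho x t1) (introN eqP ne) cB).
by rewrite /= rho_cst// subrr eqxx.
Qed.

(** Division by the density is thus legitimate up to the boundary and at all
    times. *)
Let rho_neq0 x t : closure Om x -> t1 <= t <= t2 -> rho x t != 0.
Proof.
move=> cx tt; rewrite rho_cst_closure//.
have [Ox|nOx] := pselect (Om x); first by rewrite gt_eqF// rho_gt0.
by apply: rho_bd; split => // /interior_subset.
Qed.

Let dm x t : closure Om x -> t1 <= t <= t2 -> differentiable (m x) t /\
  derive1 (m x) t = 'D_(0, 1) (fun p => m p.1 p.2) (x, t).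
Proof.
move=> cx tt; have dF := c1_differentiable (c1m (QP cx tt)).
have [d e1] := derive1_slice dF; split => //.
exact/derivable1_diffP.
Qed.

Let dH x t : closure Om x -> t1 <= t <= t2 -> differentiable (H x) t /\
  derive1 (H x) t = 'D_(0, 1) (fun p => H p.1 p.2) (x, t).
Proof.
move=> cx tt; have dF := c1_differentiable (c1H (QP cx tt)).1.
have [d e1] := derive1_slice dF; split => //.
exact/derivable1_diffP.
Qed.

Let cJ x t : closure Om x -> t1 <= t <= t2 ->
  c1v (fun p => J p.1 p.2) (x, t).
Proof. by move=> cx tt; have [] := c1H (QP cx tt); exact: c1_curl. Qed.

(** The density of internal energy, with the density frozen at its initial
    value so that its time derivative is that of E and m alone. *)
Definition heat_content (x : 'rV[R]_3) (t : R) : R :=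
  E x t - 2^-1 * (rho x t1)^-1 * normsq (m x t).

(** The power of the Lorentz force in the energy equation is the time
    derivative of the kinetic energy, by the momentum equation; Joule heating
    remains. *)
Lemma heat_content_derive x t : Om x -> t1 <= t <= t2 ->
  is_derive t (1 : R) (heat_content x) (r * normsq (J x t)).
Proof.
move=> Ox tt; have cx := subO Ox.
have [_ em eE _] := eqns Ox tt.
have [dmx _] := dm cx tt.
have [dE _] := derive1_slice (c1_differentiable (c1E (QP cx tt))).
have dE' : is_derive t (1 : R) (E x) (derive1 (E x) t).
  by rewrite derive1E; exact: derivableP.
have h := is_deriveB dE' (is_deriveZ (2^-1 * (rho x t1)^-1) (is_derive_normsq dmx)).
apply: (is_derive_eq h).
have -> : derive1 (m x) t = mu *: cross (J x t) (H x t) by apply/eqP; rewrite -subr_eq0 em.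
have -> : derive1 (E x) t = mu * dot (cross (J x t) (H x t)) ((rho x t)^-1 *: m x t) +
   r * normsq (J x t) by move: eE => /eqP; rewrite !subr_eq add0r addrC => /eqP ->.
rewrite (rho_cst Ox tt) /GRing.scale/= [dot (m x t) _]dotC dotZl [dot _ (_ *: m x t)]dotC dotZl [dot (m x t) _]dotC.
by field; rewrite gt_eqF// rho_gt0.
Qed.

Lemma heat_contentE x t : Om x -> t1 <= t <= t2 ->
  heat_content x t = E x t - 2^-1 * rho x t * normsq (v x t) /\
  e x t = heat_content x t / rho x t1.
Proof.
move=> Ox tt; have rx := rho_gt0 Ox.
rewrite /e /internal_energy /heat_content /v /velocity normsqZ (rho_cst Ox tt).
by split; field; rewrite gt_eqF.
Qed.

Lemma joule_heat x : Om x ->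
  E x t2 - 2^-1 * rho x t2 * normsq (v x t2)
  = E x t1 - 2^-1 * rho x t1 * normsq (v x t1)
    + time_integral t1 t2 (fun t => r * normsq (J x t)).
Proof.
move=> Ox.
have tt1 : t1 <= t1 <= t2 by rewrite lexx ltW.
have tt2 : t1 <= t2 <= t2 by rewrite lexx ltW.
rewrite -(heat_contentE Ox tt1).1 -(heat_contentE Ox tt2).1.
have dk t : t1 <= t <= t2 -> is_derive t (1 : R) (heat_content x) (r * normsq (J x t)).
  exact: heat_content_derive.
rewrite /time_integral (FTC_segment t12 dk).
- by rewrite addrC subrK.
- move=> t tt; apply: for_continuousM; first exact: cst_continuous.
  have c j : {for t, continuous (fun t => J x t 0 j)}.
    exact: (for_continuous_slice2 (h := fun p => J p.1 p.2 0 j) (c1_continuous (cJ (subO Ox) tt j))).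
  exact: for_continuous_dot.
Qed.

Lemma second_law D s x : equation_of_state D s ->
  (forall t, t1 <= t <= t2 -> D ((rho x t)^-1, e x t)) -> Om x ->
  [/\ temperature s (rho x t1) (e x t1) <= temperature s (rho x t2) (e x t2),
      entropy s (rho x t1) (e x t1) <= entropy s (rho x t2) (e x t2) &
      math_entropy s (rho x t2) (e x t2) <= math_entropy s (rho x t1) (e x t1)].
Proof.
move=> eos DD Ox; have rx := rho_gt0 Ox.
have tt1 : t1 <= t1 <= t2 by rewrite lexx ltW.
have tt2 : t1 <= t2 <= t2 by rewrite lexx ltW.
pose eps t := heat_content x t * (rho x t1)^-1.
pose deps t := (rho x t1)^-1 * (r * normsq (J x t)).
have epsE t : t1 <= t <= t2 -> e x t = eps t by move=> tt; rewrite (heat_contentE Ox tt).2.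
have heps t : t1 <= t <= t2 -> is_derive t (1 : R) eps (deps t).
  move=> tt; have h := is_deriveZ (rho x t1)^-1 (heat_content_derive Ox tt).
  rewrite /eps (_ : (fun t => _) = (rho x t1)^-1 \*: heat_content x); first exact: h.
  by apply/funext => z; rewrite /= /GRing.scale/= mulrC.
have deps0 t : t1 <= t <= t2 -> 0 <= deps t.
  by move=> _; rewrite mulr_ge0 ?invr_ge0 ?(ltW rx)// mulr_ge0 ?normsq_ge0.
have Deps t : t1 <= t <= t2 -> D ((rho x t1)^-1, eps t).
  by move=> tt; have := DD t tt; rewrite epsE// rho_cst.
have [/andP[h0 h1] h2] := entropy_monotone eos t12 heps deps0 Deps.
have h3 : entropy s (rho x t1) (e x t1) <= entropy s (rho x t2) (e x t2).
  by rewrite /entropy rho_cst// !epsE.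
split => //.
- rewrite /temperature (rho_cst Ox tt2) !epsE// lef_pV2// posrE//.
  exact: lt_le_trans h1.
- by rewrite /math_entropy (rho_cst Ox tt2) !mulNr lerN2 ler_pM2l// -[in leRHS](rho_cst Ox tt2).
Qed.

Section energy.
Variables (n : 'rV[R]_3 -> 'rV[R]_3) (sigma : {measure set (borel3 R) -> \bar R}).
Hypotheses (bOm : bounded_set Om) (C1Om : C1_boundary Om).
Hypotheses (normal : outward_unit_normal Om n) (surface : surface_measure Om sigma).
Hypothesis mu_gt0 : 0 < mu.

(** The electric field in units where the induction equation reads
    mu H_t = - curl K. *)
Let K (x : 'rV[R]_3) (t : R) := r *: J x t - mu *: cross (v x t) (H x t)
              + (mu * di / rho x t) *: cross (J x t) (H x t).

(** The conditions under which K x H is C^1 near a point; they hold in a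
    neighbourhood of each slice of the closed cylinder. *)
Let regular (p : 'rV[R]_3 * R) : Prop :=
  [/\ rho p.1 p.2 != 0, c1 (fun p => rho p.1 p.2) p, c1 (fun p => m p.1 p.2) p,
      c1 (fun p => H p.1 p.2) p & c1v (fun p => J p.1 p.2) p].

Let near_regular x t : closure Om x -> t1 <= t <= t2 -> \forall y \near x, regular (y, t).
Proof.
move=> cx tt; have Qx := QP cx tt.
have crho := c1_continuous (c1_slice (F := fun p => rho p.1 p.2) (c1rho Qx)).
have n0 := near_neq0 (rho_neq0 cx tt) crho.
have [U1 [oU1 /(_ _ Qx) U1x h1]] := Ck1_on_closed Crho.
have [U2 [oU2 /(_ _ Qx) U2x h2]] := Ck1_on_closed Cm.
have [U3 [oU3 /(_ _ Qx) U3x h3]] := Ck2_on_closed CH.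
have near_slice U : open U -> U (x, t) -> \forall y \near x, U (y, t).
  move=> oU Ux; apply: (near_continuous (@slice_continuous _ _ t x)).
  exact: open_nbhs_nbhs.
have n1 := near_slice _ oU1 U1x; have n2 := near_slice _ oU2 U2x.
have n3 := near_slice _ oU3 U3x.
near=> y; split.
- by near: y.
- by apply: h1; near: y.
- by apply: h2; near: y.
- by apply: (h3 _ _).1; near: y.
- have U3y : U3 (y, t) by near: y.
  by have [] := h3 _ U3y; exact: c1_curl.
Unshelve. all: by end_near. Qed.

Let c1K p : regular p -> c1v (fun p => K p.1 p.2) p.
Proof.
move=> [rp cr cm /c1_c1v cH cj].
have cV := c1V rp cr.
have cv : c1v (fun p => v p.1 p.2) p := c1vZ cV (c1_c1v cm).
have cZ (a : R) := c1_cst a p.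
exact: (c1vD (c1vB (c1vZ (cZ r) cj) (c1vZ (cZ mu) (c1v_cross cv cH)))
  (c1vZ (c1M (cZ (mu * di)) cV) (c1v_cross cj cH))).
Qed.

(** The outward flux of K x H is the Poynting flux of the energy balance. *)
Let poynting t : t1 <= t <= t2 -> gauss Om n sigma (fun x => cross (K x t) (H x t)).
Proof.
move=> tt.
(* The field must be regular on an open neighbourhood of the closure. *)
pose V := interior [set x | regular (x, t)].
apply: (@gauss_theorem _ _ _ _ oOm normal surface bOm C1Om V).
- exact: open_interior.
- by move=> x cx; exact: near_regular.
move=> x /interior_subset/= reg; have [_ _ _ /c1_c1v cH _] := reg.
exact: (c1v_slice (c1v_cross (c1K reg) cH)).
Qed.

Let density (x : 'rV[R]_3) (t : R) : R :=
  2^-1 * rho x t * normsq (v x t) + mu / 2 * normsq (H x t).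

(** The time derivative of the energy density, in the variables m and H so
    that no derivative of the density occurs; it is written with the
    derivatives of the joint functions, which are continuous up to the
    boundary. *)
Let power (x : 'rV[R]_3) (t : R) : R :=
  (rho x t)^-1 * dot (m x t) ('D_(0, 1) (fun p => m p.1 p.2) (x, t)) +
  mu * dot (H x t) ('D_(0, 1) (fun p => H p.1 p.2) (x, t)).

Let power_continuous p : Q p -> {for p, continuous (fun p => power p.1 p.2)}.
Proof.
move=> Qp; have cm := c1m Qp; have [cH _] := c1H Qp; have cr := c1rho Qp.
have r0' : rho p.1 p.2 != 0.
  by case: p Qp {cm cH cr} => x t [/= cx It]; apply: rho_neq0 => //; move: It; rewrite in_itv.
apply: for_continuousD; apply: for_continuousM.
- by apply: for_continuousV => //; exact: c1_continuous cr.
- apply: for_continuous_dot => j; apply: for_continuous_coord.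
    exact: c1_continuous cm.
  rewrite (_ : (fun p => _) = 'D_(0, 1) (fun p => m p.1 p.2)); last by apply/funext => -[].
  exact: cm.2.
- exact: cst_continuous.
- apply: for_continuous_dot => j; apply: for_continuous_coord.
    exact: c1_continuous cH.
  rewrite (_ : (fun p => _) = 'D_(0, 1) (fun p => H p.1 p.2)); last by apply/funext => -[].
  exact: cH.2.
Qed.

Let heat_continuous p : Q p -> {for p, continuous (fun p => r * normsq (J p.1 p.2))}.
Proof.
case: p => x t [/= cx It]; have tt : t1 <= t <= t2 by move: It; rewrite in_itv.
apply: for_continuousM; first exact: cst_continuous.
by apply: for_continuous_dot => j; exact: c1_continuous (cJ cx tt j).
Qed.

Let density_continuous x t : closure Om x -> t1 <= t <= t2 ->
  {for x, continuous (density ^~ t)}.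
Proof.
move=> cx tt; have [rx cr cm cH _] := nbhs_singleton (near_regular cx tt).
have cH' := c1_continuous (c1_slice (F := fun p => H p.1 p.2) cH).
have cm' := c1_continuous (c1_slice (F := fun p => m p.1 p.2) cm).
have cr' := c1_continuous (c1_slice (F := fun p => rho p.1 p.2) cr).
apply: for_continuousD; apply: for_continuousM.
- by apply: for_continuousM => //; exact: cst_continuous.
- have cv j : {for x, continuous (fun y => v y t 0 j)}.
    rewrite (_ : (fun p => _) = fun y => (rho y t)^-1 * m y t 0 j).
      by apply: for_continuousM; [exact: for_continuousV|exact: for_continuous_coord].
    by apply/funext => q; rewrite /v /velocity mxE.
  exact: for_continuous_dot.
- exact: cst_continuous.
- by apply: for_continuous_dot => j; exact: for_continuous_coord.
Qed.

Let power_integral x : Om x -> time_integral t1 t2 (power x) = density x t2 - density x t1.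
Proof.
move=> Ox.
pose eps t := 2^-1 * (rho x t1)^-1 * normsq (m x t) + mu / 2 * normsq (H x t).
have epsE t : t1 <= t <= t2 -> density x t = eps t.
  move=> tt; rewrite /density /eps /v /velocity normsqZ (rho_cst Ox tt).
  by field; rewrite gt_eqF// rho_gt0.
have deps t : t1 <= t <= t2 -> is_derive t (1 : R) eps (power x t).
  move=> tt; have [dmx em] := dm (subO Ox) tt; have [dHx eH] := dH (subO Ox) tt.
  have h := is_deriveD (is_deriveZ (2^-1 * (rho x t1)^-1) (is_derive_normsq dmx))
    (is_deriveZ (mu / 2) (is_derive_normsq dHx)).
  apply: (is_derive_eq h); rewrite /power (rho_cst Ox tt) em eH /GRing.scale/=.
  by field; rewrite gt_eqF// rho_gt0.
rewrite /time_integral (FTC_segment t12 deps); last first.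
  move=> t tt; apply: (time_slice_continuous power_continuous (subO Ox)).
  by rewrite /= in_itv.
by rewrite !epsE// ?lexx ?ltW.
Qed.

(** The induction equation turns H . curl K into - mu H . H_t, the Hall term
    of K is orthogonal to curl H, and v x H contributes the power of the
    Lorentz force, which is the derivative of the kinetic energy. *)
Let local_balance x t : Om x -> t1 <= t <= t2 ->
  divergence (fun y => cross (K y t) (H y t)) x = - power x t - r * normsq (J x t).
Proof.
move=> Ox tt; have cx := subO Ox; have rx := rho_neq0 cx tt.
have reg := nbhs_singleton (near_regular cx tt).
have [_ cr /c1_c1v/c1v_slice cm' /c1_c1v/c1v_slice cH' /c1v_slice cJ'] := reg.
have crV : c1 (fun y => (rho y t)^-1) x by exact: c1_slice (c1V rx cr).
pose A y := cross ((rho y t)^-1 *: m y t) (H y t).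
pose C y := (r / mu) *: J y t + (di / rho y t) *: cross (J y t) (H y t).
(* A and C are the fields under the two curls of the induction equation. *)
have KE : K ^~ t = fun y => mu *: (C y - A y).
  apply/funext => y; rewrite /K /C /A -/(velocity rho m y t) -/v scalerBr scalerDr !scalerA.
  by rewrite mulrCA divff ?gt_eqF// mulr1 mulrA addrAC.
have cZ (a : R) := c1_cst a x.
have dA : cdiff A x := c1v_cdiff (c1v_cross (c1vZ crV cm') cH').
have dC : cdiff C x := c1v_cdiff (c1vD (c1vZ (cZ (r / mu)) cJ')
  (c1vZ (c1M (cZ di) crV) (c1v_cross cJ' cH'))).
have dK : cdiff (K ^~ t) x := c1v_cdiff (c1v_slice (c1K reg)).
have dHx : cdiff (H ^~ t) x := c1v_cdiff cH'.
rewrite (divergence_cross dK dHx) KE (curlZB _ dC dA) -/(J x t).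
have [_ em _ eH] := eqns Ox tt.
have -> : curl C x - curl A x = - derive1 (H x) t.
  by apply/eqP; rewrite -addr_eq0 addrC addrA addrAC; apply/eqP.
rewrite (dH cx tt).2 /power -(dm cx tt).2.
have -> : derive1 (m x) t = mu *: cross (J x t) (H x t) by apply/eqP; rewrite -subr_eq0 em.
rewrite /K /v /velocity /normsq.
move: (J x t) (H x t) (m x t) ('D_(0, 1) _ (x, t)) => j h w dh.
rewrite !dotDl !dotNl !dotZl dot_cross_id [dot (cross (_ *: w) h) j]dot_cross_swap.
rewrite [dot (cross j h) _]dotC dotZl [dot h (mu *: _)]dotC [dot w (mu *: _)]dotC !dotZl dotNl.
rewrite [dot w _]dotC [dot h dh]dotC; ring.
Qed.

Lemma energy_balance :
  volume_integral Om (density ^~ t2) + time_integral t1 t2 (fun t =>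
     surface_integral sigma (boundary Om) (fun x => dot (K x t) (cross (H x t) (n x))))
  = volume_integral Om (density ^~ t1)
    - time_integral t1 t2 (fun t => volume_integral Om (fun x => r * normsq (J x t))).
Proof.
have tt1 : t1 <= t1 <= t2 by rewrite lexx ltW.
have tt2 : t1 <= t2 <= t2 by rewrite lexx ltW.
have mO : measurable (@point3 R @^-1` Om) by exact: measurable_point3.
have iP := integrable_volume_integral oOm bOm power_continuous.
have iH := integrable_volume_integral oOm bOm (h := fun x t => r * normsq (J x t)) heat_continuous.
have surfE t : t \in `[t1, t2] ->
  surface_integral sigma (boundary Om) (fun x => dot (K x t) (cross (H x t) (n x))) =
  - volume_integral Om (power ^~ t) - volume_integral Om (fun x => r * normsq (J x t)).
  rewrite in_itv/= => tt; have [iD iF e1] := poynting tt.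
  have iPt : (@lebesgue3 R).-integrable (@point3 R @^-1` Om) (fun p => (power (point3 p) t)%:E).
    apply: integrable_bounded (power ^~ t) _ => // x cx.
    by apply: (space_slice_continuous power_continuous cx); rewrite /= in_itv.
  have iHt : (@lebesgue3 R).-integrable (@point3 R @^-1` Om) (fun p => (r * normsq (J (point3 p) t))%:E).
    apply: integrable_bounded (fun x => r * normsq (J x t)) _ => // x cx.
    by apply: (space_slice_continuous (h := fun x t => r * normsq (J x t)) heat_continuous cx); rewrite /= in_itv.
  rewrite /surface_integral /volume_integral.
  transitivity (\int[@lebesgue3 R]_(p in @point3 R @^-1` Om) (- power (point3 p) t - r * normsq (J (point3 p) t))).
    rewrite /Rintegral; congr fine.
    transitivity (\int[@lebesgue3 R]_(p in @point3 R @^-1` Om)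
        (divergence (fun y => cross (K y t) (H y t)) (point3 p))%:E)%E.
      by rewrite e1; apply: eq_integral => p _; rewrite dot_crossA.
    by apply: eq_integral => p; rewrite inE => Op; rewrite local_balance.
  rewrite RintegralB//; last first.
    by have := integrableN iPt; apply: eq_integrable.
  congr (_ - _); rewrite -mulN1r -RintegralZl//; apply: eq_Rintegral => p _.
  by rewrite mulN1r.
have mI : measurable (`[t1, t2] : set (measurableTypeR R)) by exact: measurable_itv.
rewrite [X in _ + X](_ : _ = - time_integral t1 t2 (fun t => volume_integral Om (power ^~ t))
   - time_integral t1 t2 (fun t => volume_integral Om (fun x => r * normsq (J x t)))); last first.
  rewrite /time_integral.
  transitivity (\int[@lebesgue_measure R]_(t in `[t1, t2]) (- volume_integral Om (power ^~ t)
      - volume_integral Om (fun x => r * normsq (J x t)))).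
    by apply: eq_Rintegral => t; rewrite inE => It; exact: surfE.
  rewrite RintegralB//; last by have := integrableN iP; apply: eq_integrable.
  congr (_ - _); rewrite -mulN1r -RintegralZl//; apply: eq_Rintegral => t _.
  by rewrite mulN1r.
rewrite addrA; congr (_ - _).
rewrite -(swap_space_time oOm bOm power_continuous).
have iD t : t1 <= t <= t2 -> (@lebesgue3 R).-integrable (@point3 R @^-1` Om) (fun p => (density (point3 p) t)%:E).
  move=> tt; apply: (integrable_bounded oOm bOm (f := density ^~ t)) => x cx.
  exact: density_continuous.
have -> : volume_integral Om (fun x => time_integral t1 t2 (power x)) =
  volume_integral Om (density ^~ t2) - volume_integral Om (density ^~ t1).
  rewrite /volume_integral -RintegralB//; [|exact: iD..].
  by apply: eq_Rintegral => p; rewrite inE => Op; rewrite power_integral.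
by rewrite opprB addrC subrK.
Qed.

End energy.
End solution.

Theorem proposition2p2 (R : realType)
  (Om : set 'rV[R]_3) (n : 'rV[R]_3 -> 'rV[R]_3)
  (sigma : {measure set (borel3 R) -> \bar R})
  (mu r di : R) (D : set (R * R)) (s : R * R -> R) (t1 t2 : R)
  (rho : 'rV[R]_3 -> R -> R) (m : 'rV[R]_3 -> R -> 'rV[R]_3)
  (E : 'rV[R]_3 -> R -> R) (H : 'rV[R]_3 -> R -> 'rV[R]_3)
  (v := velocity rho m) (e := internal_energy rho m E)
  (curlH := fun (x : 'rV[R]_3) (t : R) => curl (H ^~ t) x)
  (Q := closure Om `*` `[t1, t2]) :
  domain Om -> bounded_set Om -> C1_boundary Om ->
  outward_unit_normal Om n -> surface_measure Om sigma ->
  0 < mu -> 0 <= r -> 0 < di ->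
  equation_of_state D s ->
  t1 < t2 ->
  Ck_on_closed 1 Q (fun p => rho p.1 p.2) ->
  Ck_on_closed 1 Q (fun p => m p.1 p.2) ->
  Ck_on_closed 1 Q (fun p => E p.1 p.2) ->
  Ck_on_closed 2 Q (fun p => H p.1 p.2) ->
  (forall x, boundary Om x -> rho x t1 != 0) ->
  (forall x t, Om x -> t1 <= t <= t2 -> D ((rho x t)^-1, e x t)) ->
  (forall x t, Om x -> t1 <= t <= t2 ->
    [/\ derive1 (rho x) t = 0,
        derive1 (m x) t - mu *: cross (curlH x t) (H x t) = 0,
        derive1 (E x) t
          - mu * dot (cross (curlH x t) (H x t)) ((rho x t)^-1 *: m x t)
          - r * normsq (curlH x t) = 0 &
        derive1 (H x) t
          - curl (fun y => cross ((rho y t)^-1 *: m y t) (H y t)) x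
          + curl (fun y => (r / mu) *: curlH y t
                    + (di / rho y t) *: cross (curlH y t) (H y t)) x = 0]) ->
  (forall x, Om x ->
    [/\ 0 < rho x t1, 0 < e x t1 & 0 < temperature s (rho x t1) (e x t1)]) ->
  (volume_integral Om (fun x =>
      2^-1 * rho x t2 * normsq (v x t2) + mu / 2 * normsq (H x t2))
   + time_integral t1 t2 (fun t =>
       surface_integral sigma (boundary Om) (fun x =>
         dot (r *: curlH x t - mu *: cross (v x t) (H x t)
              + (mu * di / rho x t) *: cross (curlH x t) (H x t))
             (cross (H x t) (n x))))
   = volume_integral Om (fun x =>
      2^-1 * rho x t1 * normsq (v x t1) + mu / 2 * normsq (H x t1))
   - time_integral t1 t2 (fun t =>
       volume_integral Om (fun x => r * normsq (curlH x t))))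
  /\
  (forall x, Om x ->
    [/\ E x t2 - 2^-1 * rho x t2 * normsq (v x t2)
        = E x t1 - 2^-1 * rho x t1 * normsq (v x t1)
          + time_integral t1 t2 (fun t => r * normsq (curlH x t)),
        temperature s (rho x t1) (e x t1) <= temperature s (rho x t2) (e x t2),
        entropy s (rho x t1) (e x t1) <= entropy s (rho x t2) (e x t2) &
        math_entropy s (rho x t2) (e x t2)
          <= math_entropy s (rho x t1) (e x t1)]).

Proof.
move=> [oOm _ _] bOm C1Om normal surface mu_gt0 r_ge0 _ eos t12 Crho Cm CE CH rho_bd DD eqns init.
have rho_gt0 x : Om x -> 0 < rho x t1 by move=> /init[].
split.
  exact: (energy_balance oOm t12 Crho Cm CH rho_bd rho_gt0 eqns bOm C1Om normal surface mu_gt0).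
move=> x Ox.
have [h1 h2 h3] := second_law r_ge0 t12 Crho Cm CE rho_gt0 eqns eos (fun t tt => DD x t Ox tt) Ox.
split => //.
exact: (joule_heat t12 Crho Cm CE CH rho_gt0 eqns Ox).
Qed.
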